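(* For any infinite-dimensional Hilbert space $X$, there exists a generator $A$ of an exponentially stable, analytic semigroup $T$ on $X$ such that the system $\Sigma(A,0)$ has no coercive, quadratic Lyapunov function.
   Context: $\mathcal K_\infty$ is the set of continuous, strictly increasing functions $\theta:[0,\infty)\to[0,\infty)$ with $\theta(0)=0$ and $\lim_{r\to\infty}\theta(r)=\infty$. $L(X)$ denotes the bounded linear operators on $X$. $\Sigma(A,0)$ is the uncontrolled system $\dot x(t)=Ax(t)$, $x(0)=x_0$, with mild solution $T(t)x_0$. A Lyapunov function for $\Sigma(A,0)$ is a continuous $V:X\to[0,\infty)$ for which there exist $\alpha_2,\alpha_3\in\mathcal K_\infty$ with $0<V(x)\le\alpha_2(\|x\|)$ for all $x\neq0$ and $\limsup_{h\to0^+}\frac1h\big(V(T(h)x)-V(x)\big)\le-\alpha_3(\|x\|)$ for all $x\in X$. It is coercive if there is $\alpha_1\in\mathcal K_\infty$ with $\alpha_1(\|x\|)\le V(x)$ for all $x\in X$. It is quadratic if there is a self-adjoint $P\in L(X)$ with $V(x)=\langle Px,x\rangle$ for all $x\in X$. *)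

(* Defs.v *)
(* Library world: MathComp + MathComp-Analysis. *)
From HB Require Import structures.
From mathcomp Require Import all_boot all_order all_algebra complex.
From mathcomp Require Import all_classical all_reals all_analysis.

Set Implicit Arguments.
Unset Strict Implicit.
Unset Printing Implicit Defensive.

Import Order.TTheory GRing.Theory Num.Theory.
Import numFieldTopology.Exports numFieldNormedType.Exports.

Local Open Scope classical_set_scope.
Local Open Scope ring_scope.
Local Open Scope complex_scope.

Section K_infinity.
Variable R : realType.

(* Functions [0, +oo[ -> [0, +oo[ are represented by functions on R of which
   only the restriction to [0, +oo[ matters; nonnegativity there follows from
   monotonicity and the value at 0. *)
Definition class_Kinfty (alpha : R -> R) : Prop :=
  [/\ {within `[0, +oo[, continuous alpha},
      {in `[0, +oo[ &, {homo alpha : x y / x < y}},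
      alpha 0 = 0 &
      alpha r @[r --> +oo] --> +oo].

(* The open sector {z <> 0 : |arg z| < theta}, for 0 < theta <= pi. *)
Definition sector (theta : R) : set R[i] :=
  [set z | exists r phi : R,
     [/\ 0 < r, `|phi| < theta & z = (r * cos phi) +i* (r * sin phi)]].

End K_infinity.

Section Hilbert.
Variables (R : realType) (X : completeNormedModType R[i]).

(* X is a complex Hilbert space: it is complete and its norm is induced by the
   inner product dot, which is linear in its first argument. *)
Definition norm_induced_by (dot : {dot X for Num.conj}) : Prop :=
  forall x : X, dot x x = `|x| ^+ 2.

Definition infinite_dimensional : Prop :=
  ~ exists s : seq X, forall x : X,
      exists c : 'I_(size s) -> R[i], x = \sum_(i < size s) c i *: s`_i.

(* The norm of X takes its values in R[i]; they are all real. *)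
Definition rnorm (x : X) : R := complex.Re `|x|.

End Hilbert.

Section Semigroups.
Variables (R : realType) (X : completeNormedModType R[i]).

(* For a linear map on X, continuity is the same as boundedness
   (linear_bounded_continuous), so L(X) consists of the P : {linear X -> X}
   such that continuous P. Only the values T t for t >= 0 matter. *)
Record C0_semigroup (T : R -> {linear X -> X}) : Prop := {
  C0_bounded : forall t, 0 <= t -> continuous (T t);
  C0_0 : forall x, T 0 x = x;
  C0_add : forall s t x, 0 <= s -> 0 <= t -> T (s + t) x = T s (T t x);
  C0_strongly_continuous : forall x, T h x @[h --> (0 : R)^'+] --> x }.

Definition difference_quotient (T : R -> {linear X -> X}) (x : X) (h : R) : X :=
  (h^-1)%:C *: (T h x - x).

(* The unbounded operator with domain D given by the restriction of A to D is
   the generator of T. *)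
Definition generator (D : set X) (A : X -> X) (T : R -> {linear X -> X}) :
    Prop :=
  (forall x, D x <-> cvg (difference_quotient T x h @[h --> (0 : R)^'+])) /\
  (forall x, D x -> difference_quotient T x h @[h --> (0 : R)^'+] --> A x).

Definition exponentially_stable (T : R -> {linear X -> X}) : Prop :=
  exists M omega : R, 0 < omega /\
    forall t x, 0 <= t -> rnorm (T t x) <= M * expR (- omega * t) * rnorm x.

(* Holomorphy of S as a map from the open set U to L(X) with the operator
   norm; S' is the derivative at z. *)
Definition holomorphic_on (U : set R[i]) (S : R[i] -> {linear X -> X}) : Prop :=
  forall z, U z -> exists S' : {linear X -> X}, continuous S' /\
    forall eps : R, 0 < eps ->
      \forall h \near (0 : (R[i] : numFieldType)), forall x : X,
        `|S (z + h) x - S z x - h *: S' x| <= eps%:C * `|h| * `|x|.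

Definition analytic_semigroup (T : R -> {linear X -> X}) : Prop :=
  exists (theta : R) (S : R[i] -> {linear X -> X}),
    [/\ 0 < theta <= pi / 2,
        forall t x, 0 <= t -> S t%:C x = T t x,
        forall z, sector theta z -> continuous (S z),
        forall z w x, sector theta z -> sector theta w ->
          S (z + w) x = S z (S w x) &
        holomorphic_on (sector theta) S /\
        forall theta' x, 0 < theta' < theta ->
          S z x @[z --> within (sector theta')
                         (nbhs (0 : (R[i] : numFieldType)))] --> x].

End Semigroups.

Section Lyapunov.
Variables (R : realType) (X : completeNormedModType R[i]).

(* The system x' = A x, x(0) = x0 enters only through its mild solution
   t |-> T t x0, where T is the semigroup generated by A. *)
Definition lyapunov_function (T : R -> {linear X -> X}) (V : X -> R) : Prop :=
  [/\ continuous V,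
      forall x, 0 <= V x &
      exists alpha2 alpha3 : R -> R,
        [/\ class_Kinfty alpha2,
            class_Kinfty alpha3,
            forall x, x != 0 -> 0 < V x <= alpha2 (rnorm x) &
            forall x,
              (limf_esup (fun h : R => (h^-1 * (V (T h x) - V x))%:E)
                 (0 : R)^'+ <= (- alpha3 (rnorm x))%:E)%E]].

Definition coercive (V : X -> R) : Prop :=
  exists alpha1 : R -> R,
    class_Kinfty alpha1 /\ forall x, alpha1 (rnorm x) <= V x.

Definition self_adjoint (dot : {dot X for Num.conj}) (P : X -> X) : Prop :=
  forall x y, dot (P x) y = dot x (P y).

Definition quadratic (dot : {dot X for Num.conj}) (V : X -> R) : Prop :=
  exists P : {linear X -> X},
    [/\ continuous P, self_adjoint dot P & forall x, (V x)%:C = dot (P x) x].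

End Lyapunov.

(* Main.v *)
Require Import Defs.
From HB Require Import structures.
From mathcomp Require Import all_boot all_order all_algebra complex.
From mathcomp Require Import all_classical all_reals all_analysis.
From mathcomp Require Import ring lra.

(** A coercive quadratic Lyapunov function V x = <P x, x> is the square of an
    equivalent Hilbert norm for which the semigroup is contractive. So it is
    enough to find an exponentially stable analytic semigroup that is not
    contractive in any such norm. It is built from a conditional basis.

    Suppose that f n are eigenvectors, T t (f n) = exp (- 4^n t) f n. If V
    decreases along trajectories, differentiating it at t = 0 along the real
    combinations 2^-n f n +- 2^-m f m gives (with b the real part of the form
    of P)
      |b (f n, f m)| (2^(n-m) + 2^(m-n)) <= V (f n) + V (f m),
    so that for bounded f n the entries b (f n, f m) decay like 2^-|n-m|
    (almost_orthogonal). Hence V of a sum of k consecutive f n is O(k)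
    (block_sum_bounded), and by coercivity so is its squared norm. It remains to
    find a bounded sequence f n for which this fails, while the multiplication
    f n |-> exp (- 4^n z) f n still defines bounded operators.

    The operators only need uniformly bounded partial sum projections: if the
    Q k are uniformly bounded projections with Q k Q l = Q (max k l), then
    q 0 + sum_k (q (k + 1) - q k) Q k converges in norm whenever the scalar
    sequence q has bounded variation, and depends linearly and multiplicatively
    on q (ex_multiplier, multiplierM). The sequences q n = exp (- 4^n z) have
    variation at most 3 exp (- Re z) on the sector |Im z| <= Re z
    (decay_variation); boundedness, the semigroup law and exponential stability
    follow. Strong continuity at 0 holds since Q k x tends to 0
    (multiplier_to_id), and a second-order Taylor bound gives holomorphy
    (decay_family_holomorphic).

    For the basis, let u n, v n be the even and odd members of an orthonormal
    sequence, let f n = u n + sum_(n <= j <= 2 n) w (j - n) v j, and let f n and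
    v n share the rate 4^n. The k-th partial sum projection differs from an
    orthogonal one by the corner n < k <= j of the matrix w (j - n), whose
    Hilbert-Schmidt norm is at most the square root of
    sum_i i (w i)^2 (corner_sum). On the other hand the sum of the f n for
    M <= n < 2 M has the coordinates sum_(i <= r) w i, r < M, along the v j, so
    its squared norm is not O(M) if sum_i w i diverges (block_sum_large). The
    weights w i = 1 / ((i + 1) H (i + 1)), H being the harmonic sums, meet both
    requirements. On the orthogonal complement of the orthonormal sequence the
    semigroup is exp (- t); this takes care of non-separable spaces. *)

Set Implicit Arguments.
Unset Strict Implicit.
Unset Printing Implicit Defensive.

Import Order.TTheory GRing.Theory Num.Theory.
Import numFieldTopology.Exports numFieldNormedType.Exports.

Local Open Scope classical_set_scope.
Local Open Scope ring_scope.
Local Open Scope complex_scope.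

(** * Moduli and norms as real numbers *)

Section ComplexModulus.
Variable R : realType.
Implicit Types (z w : R[i]) (r : R).

(** The norms of R[i] and of X take their values in R[i]; estimates that involve
    order are done on their real parts. *)
Definition cmod (z : R[i]) : R := complex.Re `|z|.

Lemma cmodE z : `|z| = (cmod z)%:C.
Proof. by rewrite /cmod RRe_real// normr_real. Qed.

Lemma cmod_ge0 z : 0 <= cmod z.
Proof. by rewrite -ler0c -cmodE. Qed.

Lemma cmodD z w : cmod (z + w) <= cmod z + cmod w.
Proof. by rewrite -lecR rmorphD/= -!cmodE ler_normD. Qed.

Lemma cmodN z : cmod (- z) = cmod z.
Proof. by rewrite /cmod normrN. Qed.

Lemma cmodB z w : cmod (z - w) <= cmod z + cmod w.
Proof. by rewrite -(cmodN w) cmodD. Qed.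

Lemma cmodM z w : cmod (z * w) = cmod z * cmod w.
Proof. by apply: complexI; rewrite rmorphM/= -!cmodE normrM. Qed.

Lemma cmodC r : cmod r%:C = `|r|.
Proof.
by rewrite /cmod normc_def /= expr0n/= addr0 sqrtr_sqr.
Qed.

Lemma cmod0 : cmod (0 : R[i]) = 0.
Proof. by rewrite /cmod normr0. Qed.

Lemma cmod_sq z : cmod z ^+ 2 = complex.Re z ^+ 2 + complex.Im z ^+ 2.
Proof.
by apply: complexI; rewrite rmorphXn/= -cmodE -add_Re2_Im2.
Qed.

Lemma cmod_eq0 z : (cmod z == 0) = (z == 0).
Proof.
by rewrite -(inj_eq (@complexI R)) -cmodE normr_eq0.
Qed.

Lemma normRe_le z : `|complex.Re z| <= cmod z.
Proof. by rewrite -lecR -cmodE normc_ge_Re. Qed.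

Lemma normIm_le z : `|complex.Im z| <= cmod z.
Proof.
by rewrite -ler_sqr ?nnegrE ?cmod_ge0// real_normK ?num_real// cmod_sq
  lerDr sqr_ge0.
Qed.

End ComplexModulus.

Section RealNorm.
Variables (R : realType) (X : completeNormedModType R[i]).
Implicit Types (x y : X) (a : R[i]).

Lemma rnormE x : `|x| = (rnorm x)%:C.
Proof. by rewrite /rnorm RRe_real// normr_real. Qed.

Lemma rnorm_ge0 x : 0 <= rnorm x.
Proof. by rewrite -ler0c -rnormE. Qed.

Lemma rnorm0 : rnorm (0 : X) = 0.
Proof. by rewrite /rnorm normr0. Qed.

Lemma rnorm_eq0 x : (rnorm x == 0) = (x == 0).
Proof. by rewrite -(inj_eq (@complexI R)) -rnormE normr_eq0. Qed.

Lemma rnormD x y : rnorm (x + y) <= rnorm x + rnorm y.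
Proof. by rewrite -lecR rmorphD/= -!rnormE ler_normD. Qed.

Lemma rnormN x : rnorm (- x) = rnorm x.
Proof. by rewrite /rnorm normrN. Qed.

Lemma rnormB x y : rnorm (x - y) <= rnorm x + rnorm y.
Proof. by rewrite -(rnormN y) rnormD. Qed.

Lemma rnormZ a x : rnorm (a *: x) = cmod a * rnorm x.
Proof. by apply: complexI; rewrite rmorphM/= -rnormE -cmodE normrZ rnormE. Qed.

Lemma rnorm_sum I (r : seq I) (P : pred I) (F : I -> X) :
  rnorm (\sum_(i <- r | P i) F i) <= \sum_(i <- r | P i) rnorm (F i).
Proof.
elim/big_rec2: _ => [|i y x _ h]; first by rewrite rnorm0.
by apply: le_trans (rnormD _ _) _; rewrite lerD2l.
Qed.

Lemma gt0_complexE (e : R[i]) : 0 < e -> exists2 r : R, 0 < r & e = r%:C.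
Proof.
by case: e => a b; rewrite ltcE /= => /andP[/eqP-> a0]; exists a.
Qed.

Lemma cvg_rnormP (T : Type) (F : set_system T) {FF : Filter F} (f : T -> X) y :
  f @ F --> y <-> forall e : R, 0 < e -> \forall t \near F, rnorm (f t - y) <= e.
Proof.
split=> [/cvgrPdist_le h e e0|h].
  have := h e%:C; rewrite ltcR => /(_ e0); apply: filterS => t.
  by rewrite distrC rnormE lecR.
apply/cvgrPdist_le => _/gt0_complexE[e e0 ->]; have := h _ e0.
by apply: filterS => t; rewrite distrC rnormE lecR.
Qed.

Lemma cvg_rnorm (T : Type) (F : set_system T) {FF : Filter F} (f : T -> X) y :
  f @ F --> y -> rnorm (f t) @[t --> F] --> rnorm y.
Proof.
move=> /cvg_rnormP h; apply/cvgrPdist_le => e e0.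
apply: filterS (h _ e0) => t le.
have h1 := rnormD (f t - y) y; rewrite subrK in h1.
have h2 := rnormB (f t) (f t - y).
rewrite (_ : f t - (f t - y) = y) in h2; last by rewrite opprB addrC subrK.
by rewrite ler_norml; lra.
Qed.

Lemma cvg_rnorm_le (T : Type) (F : set_system T) {FF : ProperFilter F}
    (f : T -> X) y (b : R) :
  f @ F --> y -> (\forall t \near F, rnorm (f t) <= b) -> rnorm y <= b.
Proof.
move=> fy h; apply: (@closed_cvg _ _ F FF (fun t => rnorm (f t)) [set r | r <= b]).
- exact: closed_le.
- exact: h.
- exact: cvg_rnorm.
Qed.

(** The passage from estimates on real-valued norms to continuity. *)
Lemma bounded_linear_cont (f : {linear X -> X}) (K : R) :
  (forall x, rnorm (f x) <= K * rnorm x) -> continuous f.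
Proof.
move=> fK x; apply/cvg_rnormP => e e0.
have K1 : 0 < `|K| + 1 by rewrite ltr_wpDl.
have h : \forall y \near x, rnorm (y - x) <= e / (`|K| + 1).
  by have /cvg_rnormP := @cvg_id _ (nbhs x); apply; rewrite divr_gt0.
apply: filterS h => y h; rewrite -raddfB.
apply: le_trans (fK _) _; apply: (@le_trans _ _ ((`|K| + 1) * rnorm (y - x))).
  by rewrite ler_wpM2r ?rnorm_ge0//; have := ler_norm K; lra.
by rewrite mulrC -ler_pdivlMr.
Qed.

Lemma complete_rnorm (u : nat -> X) :
  (forall e : R, 0 < e ->
     exists N, forall m n, (N <= m)%N -> (m <= n)%N -> rnorm (u n - u m) <= e) ->
  cvgn u.
Proof.
move=> h; apply/cauchy_cvgP/cauchyP => _/gt0_complexE[e e0 ->].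
have e20 : 0 < e / 2 by rewrite divr_gt0.
have [N hN] := h _ e20.
exists (u N); exists N => //= n Nn.
rewrite -ball_normE /= distrC rnormE ltcR.
by apply: le_lt_trans (hN _ _ _ Nn) _ => //; lra.
Qed.

End RealNorm.

(** * Elementary estimates for the exponential *)

Section ElementaryEstimates.
Variable R : realType.
Implicit Types x y : R.

Lemma mean_value_bound (f df : R -> R) (y M : R) :
  (forall x, is_derive x 1 f (df x)) -> f 0 = 0 ->
  (forall c, `|c| <= `|y| -> `|df c| <= M) -> `|f y| <= M * `|y|.
Proof.
move=> Hf f0 Hd.
have cf a b : {within `[a, b], continuous f}.
  apply/continuous_subspaceT => r; apply/differentiable_continuous.
  by apply/derivable1_diffP; have := Hf r; case.
have [y0|y0|->] := ltgtP y 0; last by rewrite f0 !normr0 mulr0.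
- have [c] := MVT_segment (ltW y0) (fun x _ => Hf x) (cf y 0).
  rewrite in_itv/= => /andP[yc c0]; rewrite f0 !sub0r => h.
  rewrite -normrN h normrM normrN ler_wpM2r// Hd// !ler0_norm ?lerN2//.
  exact: ltW.
- have [c] := MVT_segment (ltW y0) (fun x _ => Hf x) (cf 0 y).
  rewrite in_itv/= => /andP[c0 cy]; rewrite f0 !subr0 => h.
  rewrite h normrM ler_wpM2r// Hd// !ger0_norm//.
  exact: ltW.
Qed.

Lemma norm_sin_le y : `|sin y| <= `|y|.
Proof.
rewrite -[leRHS]mul1r; apply: (@mean_value_bound sin cos); rewrite ?sin0//.
by move=> c _; exact: cos_max.
Qed.

Lemma norm_cosB1_of_sin y M : (forall c, `|c| <= `|y| -> `|sin c| <= M) ->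
  `|cos y - 1| <= M * `|y|.
Proof.
move=> h; apply: (@mean_value_bound (fun x => cos x - 1) (fun x => - sin x)).
- by move=> x; apply: is_derive_eq; rewrite subr0.
- by rewrite cos0 subrr.
- by move=> c /h; rewrite normrN.
Qed.

Lemma norm_cosB1_le y : `|cos y - 1| <= `|y|.
Proof.
by rewrite -[leRHS]mul1r; apply: norm_cosB1_of_sin => c _; exact: sin_max.
Qed.

Lemma norm_cosB1_sqr y : `|cos y - 1| <= y ^+ 2.
Proof.
rewrite -real_normK ?num_real// expr2; apply: norm_cosB1_of_sin => c cy.
by apply: le_trans cy; exact: norm_sin_le.
Qed.

Lemma norm_sinBid_sqr y : `|sin y - y| <= y ^+ 2.
Proof.
rewrite -real_normK ?num_real// expr2.
apply: (@mean_value_bound (fun x => sin x - x) (fun x => cos x - 1)).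
- by rewrite sin0 subr0.
- by move=> c cy; apply: le_trans cy; exact: norm_cosB1_le.
Qed.

Lemma expRB1_le x : expR x - 1 <= x * expR x.
Proof.
have := expR_ge1Dx (- x); rewrite expRN => h.
have e0 := expR_gt0 x.
have : (1 - x) * expR x <= (expR x)^-1 * expR x by rewrite ler_pM2r.
by rewrite mulVf ?gt_eqF//; lra.
Qed.

Lemma norm_expRB1_le x : `|expR x - 1| <= `|x| * expR `|x|.
Proof.
have [x0|x0] := leP 0 x.
  rewrite (ger0_norm x0) ger0_norm; first exact: expRB1_le.
  by rewrite subr_ge0 -expR0 ler_expR.
rewrite ler0_norm; last by rewrite subr_le0 expR_le1 ltW.
apply: (@le_trans _ _ `|x|); last first.
  by rewrite -[leLHS]mulr1 ler_wpM2l// -expR0 ler_expR.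
by rewrite (ler0_norm (ltW x0)); have := expR_ge1Dx x; lra.
Qed.

Lemma norm_expR_rem x : `|expR x - 1 - x| <= x ^+ 2 * expR `|x|.
Proof.
rewrite ger0_norm; last by have := expR_ge1Dx x; lra.
apply: (@le_trans _ _ (x * (expR x - 1))); first by have := expRB1_le x; lra.
apply: le_trans (ler_norm _) _; rewrite normrM -real_normK ?num_real// expr2.
by rewrite -mulrA ler_wpM2l// norm_expRB1_le.
Qed.

End ElementaryEstimates.

Section ComplexExponential.
Variable R : realType.
Implicit Types z w : R[i].

Definition cexp z : R[i] :=
  (expR (complex.Re z) * cos (complex.Im z)) +i*
  (expR (complex.Re z) * sin (complex.Im z)).

Lemma cexpD z w : cexp (z + w) = cexp z * cexp w.
Proof.
case: z w => [a b] [c d]; rewrite /cexp /= expRD cosD sinD.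
apply/eqP; rewrite eq_complex /=; apply/andP; split; apply/eqP; ring.
Qed.

Lemma cexp_real (r : R) : cexp r%:C = (expR r)%:C.
Proof. by rewrite /cexp /= cos0 sin0 mulr1 mulr0. Qed.

Lemma cexp0 : cexp 0 = 1.
Proof. by rewrite -(rmorph0 (real_complex R)) cexp_real expR0. Qed.

Lemma cmod_cexp z : cmod (cexp z) = expR (complex.Re z).
Proof.
have h : cmod (cexp z) ^+ 2 = expR (complex.Re z) ^+ 2.
  by rewrite cmod_sq /= !exprMn -mulrDr cos2Dsin2 mulr1.
by apply/eqP; rewrite -(@eqrXn2 _ 2) ?cmod_ge0 ?expR_ge0//; apply/eqP.
Qed.

Lemma cmod_le_ReIm z : cmod z <= `|complex.Re z| + `|complex.Im z|.
Proof.
rewrite [X in cmod X]complexE; apply: le_trans (cmodD _ _) _.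
rewrite cmodM !cmodC lerD2l -[leRHS]mul1r ler_wpM2r//.
by rewrite /cmod normc_def /= expr0n/= add0r expr1n sqrtr1.
Qed.

(** The bound is global in w, because it is applied to w = - 4^n h uniformly
    in n. *)
Lemma cexp_rem w : cmod (cexp w - 1 - w) <= 4 * cmod w ^+ 2 * expR (cmod w).
Proof.
set m := cmod w; have m0 : 0 <= m := cmod_ge0 w.
have xm := normRe_le w; have ym := normIm_le w; rewrite -/m in xm ym.
apply: le_trans (cmod_le_ReIm _) _.
case: w => x y in m m0 xm ym *; rewrite /= in xm ym *.
rewrite !subr0 (_ : expR x * cos y - 1 - x =
  expR x * (cos y - 1) + (expR x - 1 - x)); last by ring.
rewrite (_ : expR x * sin y - y = expR x * (sin y - y) + y * (expR x - 1)); last by ring.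
have ex : expR x <= expR m by rewrite ler_expR; apply: le_trans (ler_norm _) _.
have ex' : expR `|x| <= expR m by rewrite ler_expR.
have sq (t : R) : `|t| <= m -> t ^+ 2 <= m ^+ 2.
  by move=> tm; rewrite -real_normK ?num_real// lerXn2r ?nnegrE.
have h1 : `|expR x * (cos y - 1)| <= m ^+ 2 * expR m.
  rewrite normrM (ger0_norm (expR_ge0 _)) mulrC ler_pM ?expR_ge0//.
  by apply: le_trans (norm_cosB1_sqr _) _; exact: sq.
have h2 : `|expR x * (sin y - y)| <= m ^+ 2 * expR m.
  rewrite normrM (ger0_norm (expR_ge0 _)) mulrC ler_pM ?expR_ge0//.
  by apply: le_trans (norm_sinBid_sqr _) _; exact: sq.
have h3 : `|expR x - 1 - x| <= m ^+ 2 * expR m.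
  apply: le_trans (norm_expR_rem _) _.
  by rewrite ler_pM ?sqr_ge0 ?expR_ge0//; exact: sq.
have h4 : `|y * (expR x - 1)| <= m ^+ 2 * expR m.
  rewrite normrM expr2 -mulrA ler_pM//.
  apply: le_trans (norm_expRB1_le _) _.
  by rewrite ler_pM ?expR_ge0.
have h5 := ler_normD (expR x * (cos y - 1)) (expR x - 1 - x).
have h6 := ler_normD (expR x * (sin y - y)) (y * (expR x - 1)).
lra.
Qed.

(** In the sector where the imaginary part is dominated by the real part,
    the increment of the complex exponential is controlled by that of its
    modulus; increments of the modulus telescope. *)
Lemma cexp_variation w : 0 <= complex.Re w -> `|complex.Im w| <= complex.Re w ->
  cmod (1 - cexp (- w)) <= 3 * (1 - expR (- complex.Re w)).
Proof.
case: w => x y /= x0 yx; apply: le_trans (cmod_le_ReIm _) _; rewrite /= sub0r.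
rewrite normrN (_ : 1 - _ = (1 - expR (- x)) - expR (- x) * (cos (- y) - 1)); last by ring.
have e0 := expR_ge0 (- x).
have h1 : `|expR (- x) * (cos (- y) - 1)| <= expR (- x) * x.
  rewrite normrM (ger0_norm e0) ler_wpM2l//.
  by apply: le_trans (norm_cosB1_le _) _; rewrite normrN.
have h2 : `|expR (- x) * sin (- y)| <= expR (- x) * x.
  rewrite normrM (ger0_norm e0) ler_wpM2l//.
  by apply: le_trans (norm_sin_le _) _; rewrite normrN.
have h3 : expR (- x) * x <= 1 - expR (- x).
  by have := expRB1_le (- x); rewrite mulNr; lra.
have h4 : `|1 - expR (- x)| = 1 - expR (- x).
  by rewrite ger0_norm// subr_ge0 expR_le1 oppr_le0.
have h5 := ler_normB (1 - expR (- x)) (expR (- x) * (cos (- y) - 1)).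
lra.
Qed.

End ComplexExponential.

(** * Exponential multipliers *)

Section Multipliers.
Variable R : realType.
Implicit Types (z h w : R[i]) (q : nat -> R[i]) (n k N : nat).

Definition seq_variation q N : R := \sum_(k < N) cmod (q k.+1 - q k).

(** Lacunary rates make the eigenvectors almost orthogonal for every Lyapunov
    form; powers of 4 have square roots that are easy to handle. *)
Definition rate n : R := 4 ^+ n.

Lemma rate_gt0 n : 0 < rate n.
Proof. by rewrite exprn_gt0. Qed.

Lemma rate_ge1 n : 1 <= rate n.
Proof. by rewrite exprn_ege1// ler1n. Qed.

Lemma rateS n : rate n.+1 = 4 * rate n.
Proof. by rewrite /rate exprS. Qed.

Definition decay z n : R[i] := cexp (- ((rate n)%:C * z)).

Lemma decayD z w n : decay (z + w) n = decay z n * decay w n.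
Proof. by rewrite /decay mulrDr opprD cexpD. Qed.

Lemma decay_at0 n : decay 0 n = 1.
Proof. by rewrite /decay mulr0 oppr0 cexp0. Qed.

Lemma decay_real (t : R) n : decay t%:C n = (expR (- (rate n * t)))%:C.
Proof. by rewrite /decay -rmorphM/= -rmorphN/= cexp_real. Qed.

Lemma cmod_decay z n : cmod (decay z n) = expR (- (rate n * complex.Re z)).
Proof.
by rewrite /decay cmod_cexp; case: z => x y /=; rewrite mul0r subr0.
Qed.

(** Closed under addition and containing 0, this is a convenient closed sector
    on which all estimates are uniform. *)
Definition cone : set R[i] :=
  [set z | 0 <= complex.Re z /\ `|complex.Im z| <= complex.Re z].

(** The sums of increments telescope, whence a bound that is uniform in N and
    decays exponentially with the real part of z. *)
Lemma decay_variation z N : cone z ->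
  seq_variation (decay z) N <= 3 * expR (- complex.Re z).
Proof.
move=> [x0 yx]; set x := complex.Re z in x0 yx *.
pose E n := expR (- (rate n * x)).
have step n : cmod (decay z n.+1 - decay z n) <= 3 * (E n - E n.+1).
  have -> : decay z n.+1 - decay z n =
      - (decay z n * (1 - cexp (- ((3 * rate n)%:C * z)))).
    rewrite mulrBr mulr1 opprB; congr (_ - _).
    rewrite /decay -cexpD rateS; congr cexp.
    rewrite -opprD -mulrDl -rmorphD/=; congr (- (_%:C * _)); ring.
  rewrite cmodN cmodM cmod_decay -/x.
  have r0 : 0 <= 3 * rate n by rewrite mulr_ge0// ltW// rate_gt0.
  have RE : complex.Re ((3 * rate n)%:C * z) = 3 * rate n * x.
    by rewrite /x; case: (z) => ? ? /=; rewrite mul0r subr0.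
  have IM : complex.Im ((3 * rate n)%:C * z) = 3 * rate n * complex.Im z.
    by case: (z) => ? ? /=; rewrite mul0r addr0.
  have := @cexp_variation R ((3 * rate n)%:C * z).
  rewrite RE IM => /(_ (mulr_ge0 r0 x0)).
  rewrite normrM (ger0_norm r0) ler_wpM2l// => /(_ isT) hv.
  have -> : E n.+1 = E n * expR (- (3 * rate n * x)).
    by rewrite /E -expRD rateS; congr expR; ring.
  have := ler_wpM2l (expR_ge0 (- (rate n * x))) hv.
  rewrite -/(E n); lra.
apply: (@le_trans _ _ (3 * (E 0%N - E N))).
  rewrite /seq_variation; elim: N => [|N IH]; first by rewrite big_ord0 subrr mulr0.
  by rewrite big_ord_recr /=; have := step N; lra.
have : 0 <= E N by exact: expR_ge0.
have -> : E 0%N = expR (- x) by rewrite /E /rate expr0 mul1r.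
lra.
Qed.

Lemma cmod_decay0 z : cmod (decay z 0) = expR (- complex.Re z).
Proof. by rewrite cmod_decay /rate expr0 mul1r. Qed.

(** Geometrically decaying multipliers have finite variation; this is how
    derivatives and Taylor remainders of the semigroup are controlled. *)
Lemma geometric_variation q (B : R) N : (forall n, cmod (q n) <= B / rate n) ->
  seq_variation q N <= 2 * B.
Proof.
move=> qB; have B0 : 0 <= B.
  by have := le_trans (cmod_ge0 _) (qB 0%N); rewrite /rate expr0 divr1.
(* 5/3 of the geometric series: each increment costs B (1 + 1/4) / 4^k, and
   1 / 4^k = (4/3) (1 / 4^k - 1 / 4^(k+1)). *)
have : seq_variation q N <= 5 / 3 * (B - B / rate N).
  rewrite /seq_variation; elim: N => [|N IH].
    by rewrite big_ord0 /rate expr0 divr1 subrr mulr0.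
  rewrite big_ord_recr /=.
  have h1 := cmodB (q N.+1) (q N); have h2 := qB N; have h3 := qB N.+1.
  move: h3; rewrite rateS => h3.
  have e : B / (4 * rate N) = B / rate N / 4.
    by field; rewrite gt_eqF ?rate_gt0.
  by rewrite e in h3 *; lra.
have : 0 <= B / rate N by rewrite divr_ge0// ltW// rate_gt0.
by lra.
Qed.

(** The derivative of decay z n in z. *)
Definition decay' z n : R[i] := - ((rate n)%:C * decay z n).

(** From exp y >= (y / 3)^3. *)
Lemma rate_expR_le (r : R) n : 0 < r ->
  rate n ^+ 2 * expR (- (rate n * r)) <= 27 / r ^+ 3 / rate n.
Proof.
move=> r0; have l0 := rate_gt0 n; set l := rate n in l0 *.
have lr0 : 0 < l * r by rewrite mulr_gt0.
have h : (l * r / 3) ^+ 3 <= expR (l * r).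
  have -> : l * r = (l * r / 3) * 3%:R by field.
  rewrite expRM_natr mulfK// lerXn2r ?nnegrE ?expR_ge0//.
    by rewrite divr_ge0// ltW.
  by have := expR_ge1Dx (l * r / 3); lra.
have h3 : 0 < (l * r / 3) ^+ 3 by rewrite exprn_gt0// divr_gt0.
rewrite expRN; apply: (@le_trans _ _ (l ^+ 2 * ((l * r / 3) ^+ 3)^-1)).
  by rewrite ler_wpM2l ?sqr_ge0// lef_pV2 ?posrE ?expR_gt0.
rewrite le_eqVlt; apply/orP; left; apply/eqP; field.
by rewrite !gt_eqF.
Qed.

Lemma decay'_bound z n : 0 < complex.Re z ->
  cmod (decay' z n) <= (27 / complex.Re z ^+ 3) / rate n.
Proof.
move=> x0; apply: le_trans (rate_expR_le n x0).
rewrite cmodN cmodM cmod_decay cmodC ger0_norm ?(ltW (rate_gt0 n))//.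
rewrite ler_wpM2r ?expR_ge0// expr2 -[leLHS]mulr1.
by rewrite ler_wpM2l ?rate_ge1// ltW// rate_gt0.
Qed.

(** The Taylor remainder in z loses two powers of the rate, which half of the
    exponential decay absorbs: hence the restriction on h. *)
Lemma decay_taylor z h n : 0 < complex.Re z -> cmod h <= complex.Re z / 2 ->
  cmod (decay (z + h) n - decay z n - h * decay' z n) <=
  (4 * (27 / (complex.Re z / 2) ^+ 3) * cmod h ^+ 2) / rate n.
Proof.
move=> x0 hx; have l0 := ltW (rate_gt0 n); set x := complex.Re z in x0 hx *.
rewrite decayD /decay'.
have -> : decay z n * decay h n - decay z n - h * - ((rate n)%:C * decay z n)
  = decay z n * (cexp (- ((rate n)%:C * h)) - 1 - (- ((rate n)%:C * h))).
  by rewrite /(decay h n); ring.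
rewrite cmodM cmod_decay -/x.
have := @cexp_rem R (- ((rate n)%:C * h)).
rewrite cmodN cmodM cmodC (ger0_norm l0) => hr.
apply: le_trans (ler_wpM2l (expR_ge0 _) hr) _.
have e1 : expR (- (rate n * x)) * expR (rate n * cmod h) <=
    expR (- (rate n * (x / 2))).
  rewrite -expRD ler_expR.
  have : rate n * cmod h <= rate n * (x / 2) by rewrite ler_wpM2l.
  lra.
have c0 : 0 <= 4 * (rate n * cmod h) ^+ 2 by rewrite mulr_ge0// sqr_ge0.
apply: (@le_trans _ _ (4 * cmod h ^+ 2 *
    (rate n ^+ 2 * expR (- (rate n * (x / 2)))))).
  have := ler_wpM2l c0 e1; rewrite exprMn; lra.
have x20 : 0 < x / 2 by rewrite divr_gt0.
have c1 : 0 <= 4 * cmod h ^+ 2 by rewrite mulr_ge0// sqr_ge0.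
have := ler_wpM2l c1 (rate_expR_le n x20); lra.
Qed.

Lemma decay_near1 z n : rate n * cmod z <= 1 ->
  cmod (decay z n - 1) <= (1 + 4 * expR 1) * rate n * cmod z.
Proof.
move=> h; have l0 := ltW (rate_gt0 n).
have := @cexp_rem R (- ((rate n)%:C * z)); rewrite -/(decay z n).
rewrite cmodN cmodM cmodC (ger0_norm l0); set m := rate n * cmod z => hr.
have m0 : 0 <= m by rewrite mulr_ge0 ?cmod_ge0.
have := cmodD (decay z n - 1 - (- ((rate n)%:C * z))) (- ((rate n)%:C * z)).
rewrite subrK cmodN cmodM cmodC (ger0_norm l0) -/m => /le_trans; apply.
rewrite -mulrA -/m.
have e1 : expR m <= expR 1 by rewrite ler_expR.
have m2 : m ^+ 2 <= m by rewrite expr2 -[leRHS]mulr1 ler_wpM2l.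
have : m ^+ 2 * expR m <= m * expR 1 by rewrite ler_pM ?sqr_ge0 ?expR_ge0.
lra.
Qed.

End Multipliers.

(** * A functional calculus for chains of projections *)

Section Increments.
Variable R : realType.

Lemma bounded_increments (S : nat -> R) (D : R) :
  {homo S : m n / (m <= n)%N >-> m <= n} -> (forall n, S n <= D) ->
  forall e, 0 < e -> exists N, forall m n, (N <= m)%N -> (m <= n)%N ->
    S n - S m <= e.
Proof.
move=> mono bd e e0.
have cS : cvgn S.
  by apply: nondecreasing_is_cvgn => //; exists D => _ [n _ <-].
have e20 : 0 < e / 2 by rewrite divr_gt0.
have := cS => /cvgrPdist_le /(_ _ e20) [N _ hN].
exists N => m n Nm mn.
have := hN _ (leq_trans Nm mn); have := hN _ Nm.
by rewrite /= !ler_norml; lra.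
Qed.

Lemma sum_ord_sub (V : zmodType) (F : nat -> V) m n : (m <= n)%N ->
  \sum_(k < n) F k - \sum_(k < m) F k = \sum_(m <= k < n) F k.
Proof.
move=> mn; rewrite -!(big_mkord xpredT F) (big_cat_nat (leq0n m) mn) /=.
by rewrite addrAC subrr add0r.
Qed.

End Increments.

Section LinearLimits.
Variables (R : realType) (X : completeNormedModType R[i]).

Lemma ex_linear (f : X -> X) : linear f ->
  exists F : {linear X -> X}, forall x, F x = f x.
Proof.
move=> fl; pose Lm := GRing.isLinear.Build _ _ _ _ f fl.
by pose F : {linear X -> X} := HB.pack f Lm; exists F.
Qed.

Lemma ex_linear_lim (f : nat -> X -> X) :
  (forall n, linear (f n)) -> (forall x, cvgn (f ^~ x)) ->
  exists F : {linear X -> X}, forall x, f n x @[n --> \oo] --> F x.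
Proof.
move=> fl fc; have lim_lin : linear (fun x => limn (f ^~ x)).
  move=> a x y; apply: cvg_lim => //.
  rewrite (_ : f ^~ _ = fun n => a *: f n x + f n y); last first.
    by apply/funext => n; rewrite fl.
  by apply: cvgD; [apply: cvgZr; exact: fc|exact: fc].
have [F FE] := ex_linear lim_lin.
by exists F => x; rewrite FE; exact: fc.
Qed.

End LinearLimits.

Section FunctionalCalculus.
Variables (R : realType) (X : completeNormedModType R[i]).
Variables (Q : nat -> {linear X -> X}) (K : R).
Hypothesis Q_bound : forall k x, rnorm (Q k x) <= K * rnorm x.
Implicit Types (q p : nat -> R[i]) (x y : X) (N k : nat).

(** If Q k projects onto the closed span of the eigenspaces with index greater
    than k, then q 0 + sum_k (q (k + 1) - q k) Q k is, by summation by parts,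
    the operator that multiplies the n-th eigenspace by q n. In this form it
    makes sense for every q of bounded variation, whether or not the
    eigenspaces form an unconditional decomposition. *)
Definition abel_sum q N x : X :=
  q 0%N *: x + \sum_(k < N) (q k.+1 - q k) *: Q k x.

Definition multiplier q (F : X -> X) : Prop :=
  forall x, abel_sum q N x @[N --> \oo] --> F x.

Lemma abel_sumS q N x :
  abel_sum q N.+1 x = abel_sum q N x + (q N.+1 - q N) *: Q N x.
Proof. by rewrite /abel_sum big_ord_recr addrA. Qed.

Lemma abel_sum_linear q N : linear (abel_sum q N).
Proof.
move=> a x y; rewrite /abel_sum scalerDr scalerDr addrACA; congr (_ + _).
  by rewrite !scalerA mulrC.
rewrite scaler_sumr -big_split; apply: eq_bigr => k _ /=.
by rewrite linearP scalerDr !scalerA mulrC.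
Qed.

Lemma abel_sum_bound q N x :
  rnorm (abel_sum q N x) <= (cmod (q 0%N) + K * seq_variation q N) * rnorm x.
Proof.
apply: le_trans (rnormD _ _) _; rewrite rnormZ mulrDl lerD2l.
apply: le_trans (rnorm_sum _ _ _) _.
rewrite /seq_variation mulr_sumr mulr_suml; apply: ler_sum => k _.
by rewrite rnormZ mulrC mulrAC ler_wpM2r ?cmod_ge0.
Qed.

Lemma K_rnorm_ge0 x : 0 <= K * rnorm x.
Proof. exact: le_trans (rnorm_ge0 _) (Q_bound 0%N x). Qed.

Lemma ex_multiplier q (D : R) : (forall N, seq_variation q N <= D) ->
  exists F : {linear X -> X}, multiplier q F.
Proof.
move=> qD; apply: ex_linear_lim => [n|x]; first exact: abel_sum_linear.
apply: complete_rnorm => e e0; have K0 := K_rnorm_ge0 x.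
have mono : {homo seq_variation q : m n / (m <= n)%N >-> m <= n}.
  move=> m n mn; rewrite -subr_ge0 (sum_ord_sub (fun k => cmod (q k.+1 - q k)))//.
  by apply: sumr_ge0 => k _; exact: cmod_ge0.
have K1 : 0 < K * rnorm x + 1 by rewrite ltr_wpDl.
have [N hN] := bounded_increments mono qD (divr_gt0 e0 K1).
exists N => m n Nm mn; have := hN _ _ Nm mn.
rewrite (sum_ord_sub (fun k => cmod (q k.+1 - q k)))// ler_pdivlMr// => h.
rewrite /abel_sum opprD addrACA subrr add0r.
rewrite (sum_ord_sub (fun k => (q k.+1 - q k) *: Q k x))//.
apply: le_trans (rnorm_sum _ _ _) _; apply: le_trans h.
rewrite mulr_suml; apply: ler_sum => k _; rewrite rnormZ.
rewrite ler_wpM2l ?cmod_ge0//; have := Q_bound k x; lra.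
Qed.

Lemma multiplier_bound q F (D : R) : (forall N, seq_variation q N <= D) ->
  multiplier q F -> forall x, rnorm (F x) <= (cmod (q 0%N) + `|K| * D) * rnorm x.
Proof.
move=> qD Fq x; apply: (cvg_rnorm_le (Fq x)); near=> N.
apply: le_trans (abel_sum_bound q N x) _.
rewrite ler_wpM2r ?rnorm_ge0// lerD2l.
apply: le_trans (ler_norm _) _; rewrite normrM ler_wpM2l//.
rewrite ger0_norm//; by apply: sumr_ge0 => k _; exact: cmod_ge0.
Unshelve. all: by end_near. Qed.

Lemma multiplier_unique q F G : multiplier q F -> multiplier q G -> F =1 G.
Proof.
move=> Fq Gq x; rewrite -(cvg_lim _ (Fq x))//; exact: (cvg_lim _ (Gq x)).
Qed.

Lemma multiplier_lin q p F G (a : R[i]) : multiplier q F -> multiplier p G ->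
  multiplier (fun n => q n - a * p n) (fun x => F x - a *: G x).
Proof.
move=> Fq Gp x.
rewrite (_ : (fun N => _) = fun N => abel_sum q N x - a *: abel_sum p N x).
  by apply: cvgB; [exact: Fq|apply: cvgZr; exact: Gp].
apply/funext => N; rewrite /abel_sum scalerDr opprD addrACA.
congr (_ + _); first by rewrite scalerBl scalerA.
rewrite scaler_sumr -sumrB; apply: eq_bigr => k _.
rewrite scalerA -scalerBl; congr (_ *: _); ring.
Qed.

Lemma multiplier1 : multiplier (fun=> 1) id.
Proof.
move=> x; rewrite (_ : (fun N => _) = fun=> x); first exact: cvg_cst.
apply/funext => N; rewrite /abel_sum scale1r big1 ?addr0// => k _.
by rewrite subrr scale0r.
Qed.

Lemma multiplier_eigen q F x n : (forall k, Q k x = if (k < n)%N then x else 0) ->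
  multiplier q F -> F x = q n *: x.
Proof.
move=> Qx Fq; rewrite -(cvg_lim _ (Fq x))//; apply: cvg_lim => //.
have h N : abel_sum q N x = q (minn N n) *: x.
  elim: N => [|N IH]; first by rewrite /abel_sum big_ord0 addr0 min0n.
  rewrite abel_sumS IH Qx; case: ltnP => Nn.
    by rewrite (minn_idPl Nn) -scalerDl addrC subrK.
  by rewrite scaler0 addr0 (minn_idPr (leqW Nn)).
apply: cvg_near_cst; near=> N; rewrite h (minn_idPr _)//.
by near: N; exact: nbhs_infty_ge.
Unshelve. all: by end_near. Qed.

(** Since the Q k form a decreasing chain of projections, truncated Abel sums
    multiply exactly; boundedness then carries this over to the limit. *)
Lemma multiplierM q p (F G H : {linear X -> X}) (D : R) :
  (forall k l x, Q k (Q l x) = Q (maxn k l) x) ->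
  (forall N, seq_variation q N <= D) ->
  multiplier q F -> multiplier p G -> multiplier (fun n => q n * p n) H ->
  forall x, H x = F (G x).
Proof.
move=> QQ qD Fq Gp Hqp x.
have QS r N k y : (k <= N)%N -> abel_sum r k (Q N y) = r k *: Q N y.
  elim: k => [_|k IH kN]; first by rewrite /abel_sum big_ord0 addr0.
  rewrite abel_sumS IH; last exact: ltnW.
  by rewrite QQ (maxn_idPr (ltnW kN)) -scalerDl addrC subrK.
have SQ r N k y : (k <= N)%N -> Q N (abel_sum r k y) = r k *: Q N y.
  elim: k => [_|k IH kN]; first by rewrite /abel_sum big_ord0 addr0 linearZ.
  rewrite abel_sumS linearD linearZ IH; last exact: ltnW.
  by rewrite QQ (maxn_idPl (ltnW kN)) -scalerDl addrC subrK.
have SM N y : abel_sum q N (abel_sum p N y) = abel_sum (fun n => q n * p n) N y.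
  elim: N => [|N IH]; first by rewrite /abel_sum !big_ord0 !addr0 scalerA.
  rewrite [RHS]abel_sumS -IH [LHS]abel_sumS (abel_sumS p) linearD linearZ SQ//.
  have -> : abel_sum q N (abel_sum p N y + (p N.+1 - p N) *: Q N y) =
      abel_sum q N (abel_sum p N y) + (p N.+1 - p N) *: (q N *: Q N y).
    by rewrite addrC abel_sum_linear addrC QS.
  rewrite QQ maxnn -addrA; congr (_ + _).
  rewrite !scalerDr !scalerA -!scalerDl; congr (_ *: _); ring.
have := Hqp x; rewrite (_ : (fun N => _) = fun N => abel_sum q N (abel_sum p N x)); last first.
  by apply/funext => N; rewrite SM.
move=> h; apply: (@cvg_unique _ (@norm_hausdorff _ X) _ _ _ _ h).
rewrite (_ : (fun N => _) =
  fun N => abel_sum q N (G x) + abel_sum q N (abel_sum p N x - G x)); last first.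
  apply/funext => N; have := abel_sum_linear q N 1 (G x) (abel_sum p N x - G x).
  by rewrite !scale1r => <-; rewrite addrC subrK.
rewrite -[F (G x)]addr0; apply: cvgD; first exact: Fq.
apply/cvg_rnormP => e e0.
have c0 : 0 <= cmod (q 0%N) + `|K| * D.
  rewrite addr_ge0 ?cmod_ge0// mulr_ge0//.
  by apply: le_trans (qD 0%N); rewrite /seq_variation big_ord0.
have c1 : 0 < cmod (q 0%N) + `|K| * D + 1 by lra.
have := Gp x => /cvg_rnormP /(_ _ (divr_gt0 e0 c1)).
apply: filterS => N; rewrite ler_pdivlMr// => hN; rewrite subr0.
apply: le_trans (abel_sum_bound _ _ _) _; apply: le_trans hN.
rewrite mulrC ler_wpM2l ?rnorm_ge0//.
have : K * seq_variation q N <= `|K| * D; last by lra.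
apply: le_trans (ler_norm _) _; rewrite normrM ler_wpM2l// ger0_norm//.
by apply: sumr_ge0 => k _; exact: cmod_ge0.
Qed.

(** The first few terms of the Abel sum are small because the multipliers tend
    to 1 one by one, the others because Q k x is small and the variation is
    bounded. *)
Lemma multiplier_to_id (T : Type) (FT : set_system T) {FF : Filter FT}
    (q : T -> nat -> R[i]) (F : T -> X -> X) (D : R) x :
  0 <= D ->
  (forall y, Q k y @[k --> \oo] --> (0 : X)) ->
  (\forall t \near FT, multiplier (q t) (F t) /\
     forall N, seq_variation (q t) N <= D) ->
  (forall n (e : R), 0 < e -> \forall t \near FT, cmod (q t n - 1) <= e) ->
  F t x @[t --> FT] --> x.
Proof.
move=> D0 Q0 FqD q1; apply/cvg_rnormP => e e0.
have D1 : 0 < D + 1 by lra.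
have e20 : 0 < e / 2 by rewrite divr_gt0.
have := Q0 x => /cvg_rnormP /(_ _ (divr_gt0 e20 D1)) [M _ hM].
pose B := rnorm x + \sum_(k < M) 2 * rnorm (Q k x) + 1.
have S0 : 0 <= \sum_(k < M) 2 * rnorm (Q k x).
  by apply: sumr_ge0 => k _; rewrite mulr_ge0 ?rnorm_ge0.
have B0 : 0 < B by have := rnorm_ge0 x; rewrite /B; lra.
have eB : 0 < e / 2 / B by rewrite divr_gt0.
have q1M : \forall t \near FT, forall n, (n <= M)%N -> cmod (q t n - 1) <= e / 2 / B.
  elim: (M) => [|m IH].
    by apply: filterS (q1 0%N _ eB) => t h n; rewrite leqn0 => /eqP ->.
  apply: filterS2 IH (q1 m.+1 _ eB) => t h h' n.
  by rewrite leq_eqVlt => /orP[/eqP->//|]; exact: h.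
apply: filterS2 FqD q1M => t [Fq qD] h.
have lim : abel_sum (q t) N x - x @[N --> \oo] --> F t x - x.
  by apply: cvgB; [exact: Fq|exact: cvg_cst].
apply: (cvg_rnorm_le lim); near=> N.
have MN : (M <= N)%N by near: N; exact: nbhs_infty_ge.
rewrite /abel_sum addrAC -{2}[x]scale1r -scalerBl.
rewrite -(subrK (\sum_(k < M) (q t k.+1 - q t k) *: Q k x) (\sum_(k < N) _)).
rewrite (sum_ord_sub (fun k => (q t k.+1 - q t k) *: Q k x))//.
rewrite addrC -addrA.
have t1 : rnorm (\sum_(M <= k < N) (q t k.+1 - q t k) *: Q k x) <= e / 2.
  apply: le_trans (rnorm_sum _ _ _) _.
  apply: (@le_trans _ _ (\sum_(M <= k < N) cmod (q t k.+1 - q t k) * (e / 2 / (D + 1)))).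
    apply: ler_sum_nat => k /andP[Mk _]; rewrite rnormZ ler_wpM2l ?cmod_ge0//.
    by have := hM k Mk; rewrite /= subr0.
  rewrite -mulr_suml -(sum_ord_sub (fun k => cmod (q t k.+1 - q t k)))//.
  rewrite mulrA ler_pdivrMr// mulrC ler_wpM2l ?(ltW e20)//.
  have := qD N; have : 0 <= \sum_(k < M) cmod (q t k.+1 - q t k).
    by apply: sumr_ge0 => k _; exact: cmod_ge0.
  rewrite /seq_variation; lra.
have t2 : rnorm (\sum_(k < M) (q t k.+1 - q t k) *: Q k x) <=
    (e / 2 / B) * \sum_(k < M) 2 * rnorm (Q k x).
  apply: le_trans (rnorm_sum _ _ _) _; rewrite mulr_sumr; apply: ler_sum => k _.
  rewrite rnormZ mulrA ler_wpM2r ?rnorm_ge0//.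
  have := h _ (ltnW (ltn_ord k)); have := h _ (ltn_ord k).
  have := cmodB (q t k.+1 - 1) (q t k - 1); rewrite opprB addrA subrK; lra.
have t3 : rnorm ((q t 0%N - 1) *: x) <= (e / 2 / B) * rnorm x.
  by rewrite rnormZ ler_wpM2r ?rnorm_ge0// h.
have t4 : e / 2 / B * B = e / 2 by rewrite divfK// gt_eqF.
apply: le_trans (rnormD _ _) _; apply: le_trans (lerD (lexx _) (rnormD _ _)) _.
move: t4; rewrite /B -/B; move: t1 t2 t3 eB.
set c := e / 2 / B; rewrite /B !mulrDr; lra.
Unshelve. all: by end_near. Qed.

End FunctionalCalculus.

(** * Orthonormal sequences *)

Lemma sum_cauchy_schwarz (R : realType) (I : Type) (r : seq I) (P : pred I)
    (f g : I -> R) :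
  (\sum_(i <- r | P i) f i * g i) ^+ 2 <=
  (\sum_(i <- r | P i) f i ^+ 2) * \sum_(i <- r | P i) g i ^+ 2.
Proof.
elim: r => [|i r IH]; first by rewrite !big_nil expr0n/= mul0r.
rewrite !big_cons; case: (P i) => //; move: IH.
have : 0 <= \sum_(j <- r | P j) f j ^+ 2 by apply: sumr_ge0 => j _; exact: sqr_ge0.
have : 0 <= \sum_(j <- r | P j) g j ^+ 2 by apply: sumr_ge0 => j _; exact: sqr_ge0.
set A := \sum_(j <- r | P j) f j ^+ 2; set B := \sum_(j <- r | P j) g j ^+ 2.
set S := \sum_(j <- r | P j) f j * g j.
move: (f i) (g i) => x y; move: A B S => A B S B0 A0 SAB.
have h : 2 * (S * (x * y)) <= A * y ^+ 2 + B * x ^+ 2.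
  apply: le_trans (ler_norm _) _.
  have h0 : 0 <= A * y ^+ 2 + B * x ^+ 2 by rewrite addr_ge0// mulr_ge0// sqr_ge0.
  rewrite -ler_sqr ?nnegrE// real_normK ?num_real//.
  apply: (@le_trans _ _ (4 * (A * B) * (x * y) ^+ 2)).
    have := ler_wpM2r (sqr_ge0 (x * y)) SAB; lra.
  have := sqr_ge0 (A * y ^+ 2 - B * x ^+ 2); lra.
lra.
Qed.

Section InnerProduct.
Variables (R : realType) (X : completeNormedModType R[i]).
Variable dot : {dot X for Num.conj}.
Hypothesis dot_norm : norm_induced_by dot.
Implicit Types (x y : X) (a c : R[i]).

Lemma dotC x y : dot x y = (dot y x)^*%R.
Proof. by rewrite (hermC dot) expr0 mul1r. Qed.

Lemma dotZl a x y : dot (a *: x) y = a * dot x y.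
Proof. exact: linearZl_LR. Qed.

Lemma dotDl x y z : dot (x + y) z = dot x z + dot y z.
Proof. exact: linearDl. Qed.

Lemma dotBl x y z : dot (x - y) z = dot x z - dot y z.
Proof. exact: linearBl. Qed.

Lemma dot0l x : dot 0 x = 0.
Proof. exact: linear0l. Qed.

Lemma dot_suml I (r : seq I) (P : pred I) (F : I -> X) y :
  dot (\sum_(i <- r | P i) F i) y = \sum_(i <- r | P i) dot (F i) y.
Proof. exact: linear_sumlz. Qed.

Lemma dot_sumr I (r : seq I) (P : pred I) (F : I -> X) y :
  dot y (\sum_(i <- r | P i) F i) = \sum_(i <- r | P i) dot y (F i).
Proof. exact: linear_sumr. Qed.

Lemma dotZr a x y : dot x (a *: y) = a^*%R * dot x y.
Proof. by rewrite dotC dotZl rmorphM (dotC x y). Qed.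

Lemma rnorm_sq x : (rnorm x ^+ 2)%:C = dot x x.
Proof. by rewrite dot_norm rnormE rmorphXn. Qed.

Lemma pythagoras x y : dot x y = 0 ->
  rnorm (x + y) ^+ 2 = rnorm x ^+ 2 + rnorm y ^+ 2.
Proof.
move=> xy; apply: complexI; rewrite rmorphD/= !rnorm_sq.
by rewrite (hnormDd xy).
Qed.

Definition orthonormal_sequence (e : nat -> X) : Prop :=
  forall m n, dot (e m) (e n) = (m == n)%:R.

Lemma orthonormal_comp (e : nat -> X) (s : nat -> nat) :
  injective s -> orthonormal_sequence e -> orthonormal_sequence (e \o s).
Proof. by move=> si eo m n; rewrite /= eo (inj_eq si). Qed.

Section Orthonormal.
Variable e : nat -> X.
Hypothesis e_on : orthonormal_sequence e.

Lemma dot_sum_orthonormal (c : nat -> R[i]) (r : seq nat) m : uniq r ->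
  dot (\sum_(n <- r) c n *: e n) (e m) = if m \in r then c m else 0.
Proof.
elim: r => [_|n r IH /= /andP[nr ur]]; first by rewrite big_nil dot0l.
rewrite big_cons dotDl dotZl e_on IH// inE eq_sym.
have [nm|nm] := eqVneq m n; last by rewrite mulr0 add0r.
by rewrite nm (negbTE nr) addr0 mulr1.
Qed.

Lemma rnorm_sum_orthonormal (c : nat -> R[i]) (r : seq nat) : uniq r ->
  rnorm (\sum_(n <- r) c n *: e n) ^+ 2 = \sum_(n <- r) cmod (c n) ^+ 2.
Proof.
elim: r => [_|n r IH /= /andP[nr ur]].
  by rewrite !big_nil rnorm0 expr0n.
rewrite !big_cons -IH// addrC pythagoras.
  rewrite addrC; congr (_ + _).
  rewrite rnormZ exprMn (_ : rnorm (e n) ^+ 2 = 1) ?mulr1//.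
  by apply: complexI; rewrite rnorm_sq e_on eqxx.
by rewrite dotZr dot_sum_orthonormal// (negbTE nr) mulr0.
Qed.

Definition fourier_sum N x : X := \sum_(0 <= n < N) dot x (e n) *: e n.

Lemma bessel x N : \sum_(0 <= n < N) cmod (dot x (e n)) ^+ 2 <= rnorm x ^+ 2.
Proof.
rewrite -rnorm_sum_orthonormal ?iota_uniq//; set p := \sum_(_ <- _) _.
have o : dot (x - p) p = 0.
  rewrite {2}/p dot_sumr big_seq big1// => n nN.
  by rewrite dotZr dotBl dot_sum_orthonormal ?iota_uniq// nN subrr mulr0.
by have := pythagoras o; rewrite subrK => ->; rewrite lerDr sqr_ge0.
Qed.

Lemma coord_le x n : cmod (dot x (e n)) <= rnorm x.
Proof.
rewrite -ler_sqr ?nnegrE ?cmod_ge0 ?rnorm_ge0//; apply: le_trans (bessel x n.+1).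
by rewrite big_nat_recr//= lerDr; apply: sumr_ge0 => k _; exact: sqr_ge0.
Qed.

Lemma bessel_increments x (d : R) : 0 < d -> exists N, forall m n, (N <= m)%N ->
  \sum_(m <= k < n) cmod (dot x (e k)) ^+ 2 <= d.
Proof.
move=> d0; pose S n := \sum_(0 <= k < n) cmod (dot x (e k)) ^+ 2.
have mono : {homo S : m n / (m <= n)%N >-> m <= n}.
  move=> m n mn; rewrite /S (big_cat_nat (leq0n m) mn)/= lerDl.
  by apply: sumr_ge0 => k _; exact: sqr_ge0.
have [N hN] := bounded_increments mono (bessel x) d0.
exists N => m n Nm; have [nm|mn] := leqP n m; first by rewrite big_geq// ltW.
have := hN _ _ Nm (ltnW mn).
by rewrite /S (big_cat_nat (leq0n m) (ltnW mn))/= addrAC subrr add0r.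
Qed.

Lemma fourier_sum_linear N : linear (fourier_sum N).
Proof.
move=> a x y; rewrite /fourier_sum scaler_sumr -big_split; apply: eq_bigr => k _ /=.
by rewrite dotDl dotZl scalerDl scalerA.
Qed.

Lemma fourier_sum_le N x : rnorm (fourier_sum N x) <= rnorm x.
Proof.
rewrite -ler_sqr ?nnegrE ?rnorm_ge0// rnorm_sum_orthonormal ?iota_uniq//.
exact: bessel.
Qed.

(** The orthogonal projection onto the closed span of e, as the limit of the
    Fourier sums; these are Cauchy by Bessel's inequality. *)
Lemma ex_projection : exists E : {linear X -> X},
  [/\ forall x, fourier_sum N x @[N --> \oo] --> E x,
      forall x, rnorm (E x) <= rnorm x,
      forall x n, dot (E x) (e n) = dot x (e n) &
      forall n, E (e n) = e n].
Proof.
have [|x|E Elim] := @ex_linear_lim R X fourier_sum; first exact: fourier_sum_linear.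
  apply: complete_rnorm => d d0.
  have [N hN] := bessel_increments x (exprn_gt0 2 d0).
  exists N => m n Nm mn; rewrite -ler_sqr ?nnegrE ?rnorm_ge0 ?(ltW d0)//.
  rewrite /fourier_sum (big_cat_nat (leq0n m) mn)/= addrAC subrr add0r.
  by rewrite rnorm_sum_orthonormal ?iota_uniq//; exact: hN.
exists E; split=> // [x|x n|n].
- by apply: (cvg_rnorm_le (Elim x)); near=> N; exact: fourier_sum_le.
- apply/eqP; rewrite -subr_eq0 -dotBl -cmod_eq0 eq_le cmod_ge0 andbT.
  apply/ler_addgt0Pl => d d0; rewrite addr0.
  have := Elim x => /cvg_rnormP /(_ _ d0) hd.
  have [N []] := filter_ex (filterI hd (nbhs_infty_gt n)) => hN nN.
  have -> : dot (E x - x) (e n) = dot (E x - fourier_sum N x) (e n).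
    rewrite !dotBl; congr (_ - _).
    by rewrite dot_sum_orthonormal ?iota_uniq// mem_index_iota nN.
  apply: le_trans (coord_le _ _) _.
  by rewrite -rnormN opprB.
- rewrite -(cvg_lim _ (Elim (e n)))//; apply: cvg_lim => //.
  apply: cvg_near_cst; near=> N; rewrite /fourier_sum.
  have nN : n \in index_iota 0 N.
    by rewrite mem_index_iota; near: N; exact: nbhs_infty_gt.
  rewrite (bigD1_seq n)//= ?iota_uniq// e_on eqxx scale1r big1 ?addr0// => k kn.
  by rewrite e_on eq_sym (negbTE kn) scale0r.
Unshelve. all: by end_near. Qed.

End Orthonormal.

(** Gram-Schmidt: as no finite family spans X, a finite orthonormal family
    always leaves room for one more vector. *)
Lemma ex_orthonormal_sequence : infinite_dimensional X ->
  exists e : nat -> X, orthonormal_sequence e.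
Proof.
move=> Xinf.
pose onf (s : seq X) := forall i j, (i < size s)%N -> (j < size s)%N ->
  dot s`_i s`_j = (i == j)%:R.
have step (s : seq X) : exists y : X, onf s ->
    dot y y = 1 /\ forall i, (i < size s)%N -> dot y s`_i = 0.
  have [os|nos] := pselect (onf s); last by exists 0.
  have [x hx] : exists x : X, ~ exists c : 'I_(size s) -> R[i],
      x = \sum_(i < size s) c i *: s`_i.
    apply: contrapT => h; apply: Xinf; exists s => x; apply: contrapT => h'.
    by apply: h; exists x.
  pose p := \sum_(i < size s) dot x s`_i *: s`_i; pose y := x - p.
  have y0 : y != 0.
    apply/eqP => /eqP; rewrite subr_eq0 => /eqP xp; apply: hx.
    by exists (fun i => dot x s`_i).
  have yi i : (i < size s)%N -> dot y s`_i = 0.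
    move=> si; rewrite /y dotBl /p dot_suml (bigD1 (Ordinal si))//=.
    rewrite dotZl os// eqxx mulr1 big1 ?addr0 ?subrr// => j ji.
    rewrite dotZl os// (_ : (j == i :> nat) = false) ?mulr0//.
    by apply/negbTE.
  exists ((rnorm y)^-1%:C *: y) => _; split=> [|i si]; last first.
    by rewrite dotZl yi// mulr0.
  have ny : rnorm y != 0 by rewrite rnorm_eq0.
  rewrite -rnorm_sq rnormZ cmodC ger0_norm ?invr_ge0 ?rnorm_ge0//.
  by rewrite mulVf// expr1n.
have [next nextP] := choice step.
pose L := fix L n := if n is n'.+1 then rcons (L n') (next (L n')) else [::].
have sL n : size (L n) = n by elim: n => //= n IH; rewrite size_rcons IH.
pose e n := next (L n).
have LE n i : (i < n)%N -> (L n)`_i = e i.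
  elim: n => //= n IH; rewrite ltnS leq_eqVlt nth_rcons sL.
  case/orP => [/eqP->|lin]; first by rewrite ltnn eqxx.
  by rewrite lin IH.
have oL n : onf (L n).
  elim: n => [|n IH] i j; first by rewrite sL.
  have [nn nu] := nextP _ IH.
  rewrite sL !ltnS => ni nj; rewrite !LE//.
  move: ni nj; rewrite leq_eqVlt => /orP[/eqP->|ni];
    rewrite leq_eqVlt => /orP[/eqP->|nj].
  - by rewrite eqxx.
  - by rewrite gtn_eqF// -(LE n j nj) nu ?sL.
  - by rewrite ltn_eqF// dotC -(LE n i ni) nu ?sL// rmorph0.
  - by have := IH i j; rewrite sL !LE// => ->.
exists e => m n; have := oL (maxn m n).+1 m n.
by rewrite sL !LE ?ltnS ?leq_maxl ?leq_maxr// => ->.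
Qed.

End InnerProduct.

(** * Divergent weights with bounded corners *)

Section Weights.
Variable R : realType.

Definition harmonic_sum n : R := \sum_(0 <= i < n.+1) i.+1%:R^-1.

(** With d i = 1 / (i + 1) and partial sums D i, the weights are d i / D i. By
    Abel and Dini, the sum of d i / D i diverges while that of d i / D i ^ 2,
    which is the sum of (i + 1) (weight i) ^ 2, converges. *)
Definition weight i : R := (i.+1%:R * harmonic_sum i)^-1.

Lemma harmonic_sumS n : harmonic_sum n.+1 = harmonic_sum n + n.+2%:R^-1.
Proof. by rewrite /harmonic_sum big_nat_recr. Qed.

Lemma harmonic_sum_ge1 n : 1 <= harmonic_sum n.
Proof.
elim: n => [|n IH]; first by rewrite /harmonic_sum big_nat1 invr1.
by rewrite harmonic_sumS (le_trans IH)// lerDl invr_ge0.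
Qed.

Lemma weight_ge0 i : 0 <= weight i.
Proof.
by rewrite invr_ge0 mulr_ge0// (le_trans ler01)// harmonic_sum_ge1.
Qed.

(** The n-th term is at most 1 / D (n - 1) - 1 / D n, so the sum telescopes. *)
Lemma sum_weight_sqr N : \sum_(0 <= i < N) i.+1%:R * weight i ^+ 2 <= 2.
Proof.
suff h n : \sum_(0 <= i < n.+1) i.+1%:R * weight i ^+ 2 <= 2 - (harmonic_sum n)^-1.
  case: N => [|n]; first by rewrite big_geq.
  apply: le_trans (h n) _; rewrite gerBl invr_ge0.
  by have := harmonic_sum_ge1 n; lra.
elim: n => [|n IH].
  rewrite big_nat1 /weight /harmonic_sum big_nat1 !(invr1, mul1r, mulr1, expr1n).
  by lra.
rewrite big_nat_recr//=; apply: le_trans (lerD IH (lexx _)) _.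
have D0 : 0 < harmonic_sum n by have := harmonic_sum_ge1 n; lra.
rewrite /weight harmonic_sumS; set D := harmonic_sum n in D0 *.
have m0 : 0 < n.+2%:R :> R by [].
move: (n.+2%:R : R) m0 => m m0.
have Dm : 0 < D * m by rewrite mulr_gt0.
have Dm1 : 0 < D * m + 1 by lra.
have [mn Dn dn] : [/\ m != 0, D != 0 & D * m + 1 != 0] by rewrite !gt_eqF.
have E : D + m^-1 = (D * m + 1) / m by field.
rewrite E (_ : m * (m * ((D * m + 1) / m))^-1 ^+ 2 = m / (D * m + 1) ^+ 2); last first.
  by field; rewrite dn mn.
rewrite (_ : ((D * m + 1) / m)^-1 = m / (D * m + 1)); last by field; rewrite dn mn.
have -> : D^-1 = m / (D * m) by field; rewrite mn Dn.
rewrite -subr_ge0 (_ : _ - _ = m / ((D * m) * (D * m + 1) ^+ 2)).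
  by rewrite divr_ge0 ?(ltW m0)// mulr_ge0 ?sqr_ge0// ltW.
by field; rewrite ?dn ?mn ?Dn.
Qed.

(** Abel-Dini: the harmonic sums grow at most exponentially in the sums of the
    weights, so the latter inherit their divergence. *)
Lemma sum_weight_unbounded (C : R) : exists N, C < \sum_(0 <= i < N) weight i.
Proof.
apply: contrapT => h.
have wC N : \sum_(0 <= i < N) weight i <= C.
  by rewrite leNgt; apply/negP => hN; apply: h; exists N.
have grow n : harmonic_sum n <= expR (2 * \sum_(0 <= i < n.+1) weight i).
  elim: n => [|n IH].
    rewrite big_nat1 /weight /harmonic_sum big_nat1 !(invr1, mul1r, mulr1).
    by have := expR_ge1Dx (2 : R); lra.
  rewrite big_nat_recr//= mulrDr expRD.
  have D0 := harmonic_sum_ge1 n.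
  apply: (@le_trans _ _ (harmonic_sum n * (1 + 2 * weight n.+1))); last first.
    rewrite ler_pM//; [lra| |exact: expR_ge1Dx].
    by have := weight_ge0 n.+1; lra.
  rewrite mulrDr mulr1 harmonic_sumS lerD2l /weight harmonic_sumS.
  have m1 : 1 <= n.+2%:R :> R by rewrite ler1n.
  move: (harmonic_sum n) (n.+2%:R : R) D0 m1 => D m D0 m1.
  have Dm : 1 <= D * m by rewrite -[leLHS]mulr1 ler_pM.
  have [mn dn] : m != 0 /\ D * m + 1 != 0 by split; rewrite gt_eqF//; lra.
  have -> : D * (2 * (m * (D + m^-1))^-1) = m^-1 * (2 * (D * m) / (D * m + 1)).
    by field; rewrite dn mn.
  have m0 : 0 <= m^-1 by rewrite invr_ge0; lra.
  rewrite -[leLHS]mulr1 ler_wpM2l//.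
  by rewrite ler_pdivlMr; lra.
apply: (@dvg_harmonic R); apply: nondecreasing_is_cvgn.
  apply/nondecreasing_seqP => n; rewrite /series/= big_nat_recr//= lerDl.
  by rewrite invr_ge0.
exists (expR (2 * C)) => _ [n _ <-]; rewrite /series/=.
case: n => [|n]; first by rewrite big_geq ?expR_ge0.
by apply: le_trans (grow n) _; rewrite ler_expR ler_wpM2l.
Qed.

(** The diagonal j - n = i meets the corner n < k <= j in at most i points. *)
Lemma corner_sum (b : nat -> R) (s : R) k :
  (forall i, 0 <= b i) -> (forall N, \sum_(0 <= i < N) i.+1%:R * b i <= s) ->
  \sum_(0 <= n < k) \sum_(k <= j < n.*2.+1) b (j - n)%N <= s.
Proof.
move=> b0 bs; apply: le_trans (bs k).
(* A row of the corner depends on its distance k - n to the diagonal only. *)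
pose G r := \sum_(0 <= i < k) (if (r <= i)%N then b i else 0).
have inner n : (n < k)%N -> \sum_(k <= j < n.*2.+1) b (j - n)%N <= G (k - n)%N.
  move=> nk; rewrite -{1}(subnK (ltnW nk)) big_addn.
  have -> : (n.*2.+1 - n = n.+1)%N by rewrite -addnn subSn ?leq_addr// addnK.
  rewrite (eq_bigr b) => [|i _]; last by rewrite addnK.
  have [nk'|nk'] := leqP (k - n) n.+1; last first.
    rewrite big_geq ?(ltnW nk')//; apply: sumr_ge0 => i _.
    by case: ifP.
  rewrite /G (big_cat_nat (leq0n (k - n)%N)) ?leq_subr//=.
  rewrite (big_cat_nat nk' nk)/=.
  set A := \sum_(0 <= i < _) _; set B := \sum_(n.+1 <= i < k) _.
  have A0 : 0 <= A by apply: sumr_ge0 => i _; case: ifP.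
  have B0 : 0 <= B by apply: sumr_ge0 => i _; case: ifP.
  have -> : \sum_(k - n <= i < n.+1) (if (k - n <= i)%N then b i else 0) =
      \sum_(k - n <= i < n.+1) b i.
    by apply: eq_big_nat => i /andP[-> _].
  lra.
apply: (@le_trans _ _ (\sum_(0 <= n < k) G (k - n)%N)).
  by apply: ler_sum_nat => n /andP[_ nk]; exact: inner.
rewrite big_nat_rev/= add0n /G exchange_big_nat/=.
apply: ler_sum_nat => i /andP[_ ik].
rewrite (eq_big_nat _ _ (F2 := fun n => if (n < i)%N then b i else 0)); last first.
  by move=> n /andP[_ nk]; rewrite subKn.
have : \sum_(0 <= n < k) (if (n < i)%N then b i else 0) = (minn k i)%:R * b i.
  elim: (k) => [|m IH]; first by rewrite big_geq// min0n mul0r.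
  rewrite big_nat_recr//= IH; case: ltnP => mi.
    by rewrite (minn_idPl mi) -natr1 mulrDl mul1r.
  by rewrite addr0 (minn_idPr (leqW mi)).
move=> ->; rewrite ler_wpM2r// ler_nat.
by apply: leq_trans (geq_minr _ _) _.
Qed.

End Weights.

(** * A conditional basis *)

Section ConditionalBasis.
Variables (R : realType) (X : completeNormedModType R[i]).
Variable dot : {dot X for Num.conj}.
Hypothesis dot_norm : norm_induced_by dot.
Variable e : nat -> X.
Hypothesis e_on : orthonormal_sequence dot e.
Implicit Types (x y : X).

Let a i : R := weight R i.
Let u n := e n.*2.
Let v n := e n.*2.+1.

Let u_on : orthonormal_sequence dot u.
Proof. by apply: (orthonormal_comp (s := double) _ e_on) => m n /double_inj. Qed.

Let v_on : orthonormal_sequence dot v.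
Proof.
by apply: (orthonormal_comp (s := fun n => n.*2.+1) _ e_on) => m n [/double_inj].
Qed.

Let dot_uv m n : dot (u m) (v n) = 0.
Proof.
rewrite e_on (_ : _ == _ = false)//; apply/negbTE/eqP => /(congr1 odd).
by rewrite /= !odd_double.
Qed.

Let dot_vu m n : dot (v m) (u n) = 0.
Proof. by rewrite dotC dot_uv rmorph0. Qed.

(** The tail of the Toeplitz column n below the row k. The column is cut off
    at row 2 n: this keeps all sums finite, and the block of rows and columns
    between M and 2 M still contains the whole triangle j >= n. *)
Definition basis_tail n k : X := \sum_(k <= j < n.*2.+1) (a (j - n))%:C *: v j.

Definition basis_vector n : X := u n + basis_tail n n.

(** The projection onto the span of the basis vectors and the v n with n < k
    that annihilates those with n >= k. Written with the coordinates of x along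
    u and v, it is the orthogonal projection onto the u n and v n with n < k
    plus the corner operator below. *)
Definition partial_sum k x : X :=
  \sum_(0 <= n < k) (dot x (u n) *: (u n + basis_tail n k) + dot x (v n) *: v n).

Lemma dot_tail_u n k m : dot (basis_tail n k) (u m) = 0.
Proof.
by rewrite /basis_tail dot_suml big1// => j _; rewrite dotZl dot_vu mulr0.
Qed.

Lemma dot_tail_v n k m : dot (basis_tail n k) (v m) =
  if (k <= m < n.*2.+1)%N then (a (m - n))%:C else 0.
Proof.
rewrite /basis_tail (dot_sum_orthonormal v_on (fun j => (a (j - n))%:C))//.
  by rewrite mem_index_iota.
exact: iota_uniq.
Qed.

Lemma rnorm_tail_sq n k :
  rnorm (basis_tail n k) ^+ 2 = \sum_(k <= j < n.*2.+1) a (j - n) ^+ 2.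
Proof.
rewrite /basis_tail (rnorm_sum_orthonormal dot_norm v_on (fun j => (a (j - n))%:C)).
  by apply: eq_bigr => j _; rewrite cmodC real_normK ?num_real.
exact: iota_uniq.
Qed.

Lemma partial_sum_linear k : linear (partial_sum k).
Proof.
move=> c x y; rewrite /partial_sum scaler_sumr -big_split; apply: eq_bigr => n _ /=.
rewrite !dotDl !dotZl !scalerDl !scalerDr !scalerA.
by rewrite addrACA.
Qed.

Lemma partial_sum_v k n : partial_sum k (v n) = if (n < k)%N then v n else 0.
Proof.
rewrite /partial_sum (eq_bigr (fun m => (n == m)%:R *: v m)) => [|m _]; last first.
  by rewrite dot_vu v_on scale0r add0r.
have [nk|nk] := ltnP n k; last first.
  rewrite big_nat big1// => m /andP[_ mk].
  by rewrite gtn_eqF ?scale0r// (leq_trans mk).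
rewrite (bigD1_seq n) ?iota_uniq//= ?mem_index_iota// eqxx scale1r.
by rewrite big1 ?addr0// => m mn; rewrite eq_sym (negbTE mn) scale0r.
Qed.

Lemma partial_sum_u k n :
  partial_sum k (u n) = if (n < k)%N then u n + basis_tail n k else 0.
Proof.
rewrite /partial_sum (eq_bigr (fun m => (n == m)%:R *: (u m + basis_tail m k))) => [|m _]; last first.
  by rewrite dot_uv u_on scale0r addr0.
have [nk|nk] := ltnP n k; last first.
  rewrite big_nat big1// => m /andP[_ mk].
  by rewrite gtn_eqF ?scale0r// (leq_trans mk).
rewrite (bigD1_seq n) ?iota_uniq//= ?mem_index_iota// eqxx scale1r.
by rewrite big1 ?addr0// => m mn; rewrite eq_sym (negbTE mn) scale0r.
Qed.

Lemma ex_partial_sum k : exists F : {linear X -> X}, forall x, F x = partial_sum k x.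
Proof. by have [F FE] := ex_linear (partial_sum_linear k); exists F. Qed.

Lemma partial_sum_tail k l n : (l <= k)%N ->
  partial_sum k (basis_tail n l) + basis_tail n k = basis_tail n l.
Proof.
move=> lk; have [F FE] := ex_partial_sum k; rewrite -FE /basis_tail linear_sum/=.
have -> : \sum_(l <= j < n.*2.+1) F ((a (j - n))%:C *: v j) =
    \sum_(l <= j < n.*2.+1) (if (j < k)%N then (a (j - n))%:C *: v j else 0).
  by apply: eq_bigr => j _; rewrite linearZ/= FE partial_sum_v; case: ifP; rewrite ?scaler0.
have [kn|nk] := leqP k n.*2.+1; last first.
  rewrite [X in _ + X]big_geq ?(ltnW nk)// addr0; apply: eq_big_nat => j /andP[_ jn].
  by rewrite (ltn_trans jn nk).
rewrite (big_cat_nat lk kn)/= [RHS](big_cat_nat lk kn)/=; congr (_ + _).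
rewrite [X in _ + X]big_nat [X in _ + X]big1 ?addr0; last first.
  by move=> j /andP[kj _]; rewrite ltnNge kj.
by apply: eq_big_nat => j /andP[_ ->].
Qed.

Lemma partial_sum_fix k l n : (l <= k)%N -> (n < k)%N ->
  partial_sum k (u n + basis_tail n l) = u n + basis_tail n l.
Proof.
move=> lk nk; have [F FE] := ex_partial_sum k; rewrite -FE linearD/= !FE.
by rewrite partial_sum_u nk -addrA [basis_tail n k + _]addrC partial_sum_tail.
Qed.

Lemma partial_sum_basis k n :
  partial_sum k (basis_vector n) = if (n < k)%N then basis_vector n else 0.
Proof.
have [nk|kn] := ltnP n k; first by rewrite partial_sum_fix// ltnW.
have [F FE] := ex_partial_sum k; rewrite -FE /basis_vector linearD/= !FE.
rewrite partial_sum_u ltnNge kn add0r -FE /basis_tail linear_sum big_nat big1//=.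
move=> j /andP[nj _]; rewrite linearZ/= FE partial_sum_v ltnNge.
by rewrite (leq_trans kn nj) scaler0.
Qed.

Lemma partial_sumK k l x :
  partial_sum k (partial_sum l x) = partial_sum (minn k l) x.
Proof.
have [lk|/ltnW kl] := leqP l k.
  have [F FE] := ex_partial_sum k; rewrite -FE {1}/partial_sum linear_sum/=.
  apply: eq_big_nat => n /andP[_ nl].
  rewrite linearD/= !linearZ/= !FE partial_sum_v (leq_trans nl lk).
  by rewrite partial_sum_fix// (leq_trans nl).
rewrite {1}/partial_sum; apply: eq_big_nat => n /andP[_ nk].
have nl := leq_trans nk kl; congr (_ *: _ + _ *: _); rewrite /partial_sum dot_suml.
  rewrite (bigD1_seq n) ?iota_uniq//= ?mem_index_iota// big1 => [|m mn].
    by rewrite dotDl !dotZl dotDl dot_tail_u u_on eqxx dot_vu !(mulr0, addr0, mulr1).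
  by rewrite dotDl !dotZl dotDl dot_tail_u u_on (negbTE mn) dot_vu !(mulr0, addr0).
rewrite (bigD1_seq n) ?iota_uniq//= ?mem_index_iota// big1 => [|m mn].
  by rewrite dotDl !dotZl dotDl dot_tail_v leqNgt nl /= v_on eqxx dot_uv !(mulr0, addr0, add0r, mulr1).
by rewrite dotDl !dotZl dotDl dot_tail_v leqNgt nl /= v_on (negbTE mn) dot_uv !(mulr0, addr0).
Qed.

Definition corner k x : X := \sum_(0 <= n < k) dot x (u n) *: basis_tail n k.

Lemma partial_sumE k x : partial_sum k x = fourier_sum dot e k.*2 x + corner k x.
Proof.
have -> : fourier_sum dot e k.*2 x =
    \sum_(0 <= n < k) (dot x (u n) *: u n + dot x (v n) *: v n).
  rewrite /fourier_sum; elim: k => [|k IH]; first by rewrite !big_geq.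
  by rewrite doubleS !big_nat_recr//= IH addrA.
rewrite /corner -big_split; apply: eq_bigr => n _ /=.
by rewrite scalerDr addrAC.
Qed.

(** The corner only sees the coordinates between k/2 and k, because the tails
    were cut off at 2 n; this makes it vanish in the limit. *)
Lemma corner_bound k x :
  rnorm (corner k x) ^+ 2 <= 2 * \sum_(k./2 <= n < k) cmod (dot x (u n)) ^+ 2.
Proof.
have k2 : (k./2 <= k)%N.
  by rewrite -{2}(odd_double_half k) (leq_trans _ (leq_addl _ _))// -addnn leq_addr.
have -> : corner k x = \sum_(k./2 <= n < k) dot x (u n) *: basis_tail n k.
  rewrite /corner (big_cat_nat (leq0n _) k2)/= big_nat big1 ?add0r// => n /andP[_ nk].
  rewrite /basis_tail big_geq ?scaler0//.
  by rewrite -(odd_double_half k) (leq_trans _ (leq_addl _ _))// ltn_double.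
apply: (@le_trans _ _ ((\sum_(k./2 <= n < k) cmod (dot x (u n)) * rnorm (basis_tail n k)) ^+ 2)).
  rewrite lerXn2r ?nnegrE ?rnorm_ge0//.
    by apply: sumr_ge0 => n _; rewrite mulr_ge0 ?cmod_ge0 ?rnorm_ge0.
  apply: le_trans (rnorm_sum _ _ _) _; apply: ler_sum => n _.
  by rewrite rnormZ.
apply: le_trans (sum_cauchy_schwarz _ _ _ _) _; rewrite mulrC.
rewrite ler_wpM2r//; first by apply: sumr_ge0 => n _; exact: sqr_ge0.
apply: le_trans (corner_sum (b := fun i => a i ^+ 2) (s := 2) k _ _).
- rewrite (big_cat_nat (leq0n _) k2)/= -[leLHS]add0r lerD//.
    by apply: sumr_ge0 => n _; apply: sumr_ge0 => j _; exact: sqr_ge0.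
  by apply: ler_sum => n _; rewrite rnorm_tail_sq.
- by move=> i; exact: sqr_ge0.
- exact: sum_weight_sqr.
Qed.

Lemma rnorm_e n : rnorm (e n) = 1.
Proof.
apply/eqP; rewrite -(@eqrXn2 _ 2) ?rnorm_ge0// expr1n; apply/eqP/complexI.
by rewrite (rnorm_sq dot_norm) e_on eqxx.
Qed.

Lemma basis_vector_bound n : rnorm (basis_vector n) <= 3.
Proof.
apply: le_trans (rnormD _ _) _; rewrite rnorm_e.
suff : rnorm (basis_tail n n) <= 2 by lra.
rewrite -ler_sqr ?nnegrE ?rnorm_ge0// rnorm_tail_sq.
apply: (@le_trans _ _ 2); last by lra.
apply: le_trans (sum_weight_sqr R n.+1).
rewrite -{1}[n]add0n big_addn.
have -> : (n.*2.+1 - n = n.+1)%N by rewrite -addnn subSn ?leq_addr// addnK.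
apply: ler_sum => i _; rewrite addnK -[leLHS]mul1r ler_wpM2r ?sqr_ge0//.
by rewrite ler1n.
Qed.

(** The sum of a block of basis vectors has large coordinates along the v j,
    namely partial sums of the divergent series of weights. *)
Lemma block_sum_large (C : R) : exists M N : nat, (M < N)%N /\
  C * (N - M)%:R < rnorm (\sum_(M <= n < N) basis_vector n) ^+ 2.
Proof.
have [K hK] := sum_weight_unbounded (2 * `|C| + 1).
pose s r := \sum_(0 <= i < r) a i.
have s_mono r r' : (r <= r')%N -> s r <= s r'.
  move=> rr; rewrite /s (big_cat_nat (leq0n r) rr)/= lerDl.
  by apply: sumr_ge0 => i _; exact: weight_ge0.
have K0 : (0 < K)%N.
  rewrite lt0n; apply/eqP => K0; move: hK; rewrite K0 big_geq//.
  by have := normr_ge0 C; lra.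
exists K.*2, K.*2.*2; split.
  by rewrite -[X in (_ < X)%N]addnn -{1}[K.*2]addn0 ltn_add2l double_gt0.
have coord j : (K.*2 <= j < K.*2.*2)%N ->
    dot (\sum_(K.*2 <= n < K.*2.*2) basis_vector n) (v j) = (s (j.+1 - K.*2)%N)%:C.
  move=> /andP[Kj jK]; rewrite dot_suml.
  rewrite (eq_big_nat _ _ (F2 := fun n => if (n <= j)%N then (a (j - n))%:C else 0)); last first.
    move=> n /andP[Kn _]; rewrite dotDl dot_uv add0r dot_tail_v.
    case: (n <= j)%N => //=.
    by rewrite ltnS (leq_trans (ltnW jK))// leq_double.
  rewrite (big_cat_nat (leqW Kj) jK)/= [X in _ + X]big_nat [X in _ + X]big1 ?addr0; last first.
    by move=> n /andP[jn _]; rewrite leqNgt jn.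
  rewrite (eq_big_nat _ _ (F2 := fun n => (a (j - n))%:C)); last first.
    by move=> n /andP[_]; rewrite ltnS => ->.
  rewrite -rmorph_sum/=; congr (_%:C).
  rewrite big_nat_rev/= -{1}[K.*2]add0n big_addn; apply: eq_big_nat => i /andP[_ iK].
  congr a; rewrite [(i + _)%N]addnC -addnS subnDl subSS subKn//.
  by rewrite -ltnS (leq_trans iK)// leq_subr.
have := bessel dot_norm v_on (\sum_(K.*2 <= n < K.*2.*2) basis_vector n) K.*2.*2.
apply: lt_le_trans.
have K23 : (K.*2 <= K.*2 + K)%N by rewrite leq_addr.
have K34 : (K.*2 + K <= K.*2.*2)%N by rewrite -[K.*2.*2]addnn leq_add2l -addnn leq_addr.
rewrite (big_cat_nat (leq0n (K.*2 + K)) K34)/=.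
rewrite -[ltLHS]add0r; apply: ler_ltD.
  by apply: sumr_ge0 => n _; exact: sqr_ge0.
apply: (@lt_le_trans _ _ (\sum_(K.*2 + K <= n < K.*2.*2) (2 * `|C| + 1))).
  rewrite sumr_const_nat -[K.*2.*2]addnn addnK subnDl -addnn addnK -[ltRHS]mulr_natr natrD.
  have : 0 < K%:R :> R by rewrite ltr0n.
  have := ler_norm C; move: (K%:R : R) (`|C| : R) => k c Cc k0.
  have := ler_wpM2r (ltW k0) Cc; lra.
apply: ler_sum_nat => j /andP[Kj jK].
have Kj2 := leq_trans K23 Kj.
rewrite coord ?Kj2// cmodC.
have : s K <= s (j.+1 - K.*2)%N.
  by apply: s_mono; rewrite leq_subRL ?(leq_trans Kj2)// (leq_trans Kj).
rewrite real_normK ?num_real//; move: hK; rewrite -/(s K).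
move: (s (j.+1 - K.*2)%N) => q h1 h2; have C0 := normr_ge0 C.
have q1 : 1 <= q by lra.
have : 0 <= q * (q - 1) by rewrite mulr_ge0; lra.
by rewrite mulrBr mulr1 -expr2; lra.
Qed.

(** The complement of partial_sum k.+1 is taken inside the closed span of e, so
    that the Q k tend to 0 pointwise even if e is not total. On the orthogonal
    complement of e, the functional calculus then multiplies by q 0. *)
Lemma ex_projection_chain : exists Q : nat -> {linear X -> X},
  [/\ forall k x, rnorm (Q k x) <= 4 * rnorm x,
      forall k l x, Q k (Q l x) = Q (maxn k l) x,
      forall x, Q k x @[k --> \oo] --> (0 : X) &
      forall n k, Q k (basis_vector n) = if (k < n)%N then basis_vector n else 0].
Proof.
have [E [Elim Ele Edot Ee]] := ex_projection dot_norm e_on.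
have Q_lin k : linear (fun x => E x - partial_sum k.+1 x).
  by move=> c x y; rewrite linearP partial_sum_linear scalerBr opprD addrACA.
have [Q QE] := choice (fun k => ex_linear (Q_lin k)); exists Q.
have [P PE] := choice ex_partial_sum.
have Etail n k : E (basis_tail n k) = basis_tail n k.
  rewrite /basis_tail linear_sum; apply: eq_bigr => j _.
  by rewrite linearZ/= Ee.
have EP k x : E (P k x) = P k x.
  rewrite PE /partial_sum linear_sum; apply: eq_bigr => n _.
  by rewrite linearD !linearZ/= linearD/= Etail !Ee.
have PE' k x : P k (E x) = P k x.
  by rewrite !PE /partial_sum; apply: eq_bigr => n _; rewrite !Edot.
have EE x : E (E x) = E x.
  have h : fourier_sum dot e N (E x) @[N --> \oo] --> E x.
    rewrite (_ : (fun N => _) = fun N => fourier_sum dot e N x); first exact: Elim.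
    apply/funext => N.
    by rewrite /fourier_sum; apply: eq_bigr => n _; rewrite Edot.
  exact: (@cvg_unique _ (@norm_hausdorff _ X) _ _ _ _ (Elim (E x)) h).
split.
- move=> k x; rewrite QE; apply: le_trans (rnormB _ _) _.
  rewrite partial_sumE.
  have h1 := rnormD (fourier_sum dot e k.+1.*2 x) (corner k.+1 x).
  have h2 := fourier_sum_le dot_norm e_on k.+1.*2 x.
  have h3 : rnorm (corner k.+1 x) <= 2 * rnorm x.
    have r0 := rnorm_ge0 x.
    rewrite -ler_sqr ?nnegrE ?rnorm_ge0 ?mulr_ge0//.
    apply: le_trans (corner_bound _ _) _; rewrite exprMn.
    have k2 : (k.+1./2 <= k.+1)%N by rewrite ltnW// -divn2 ltn_Pdiv.
    have := bessel dot_norm u_on x k.+1; rewrite (big_cat_nat (leq0n _) k2)/=.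
    set A := \sum_(0 <= _ < _) _; set B := \sum_(_ <= _ < _) _.
    have A0 : 0 <= A by apply: sumr_ge0 => n _; exact: sqr_ge0.
    have B0 : 0 <= B by apply: sumr_ge0 => n _; exact: sqr_ge0.
    lra.
  have h4 := Ele x; lra.
- move=> k l x; rewrite !QE -!PE !linearB/= EE EP PE' !PE partial_sumK minnSS.
  have [kl|/ltnW lk] := leqP k l.
    by rewrite subrr addr0.
  by rewrite opprK addrA addrAC subrK.
- move=> x; apply/cvg_rnormP => d d0.
  have d20 : 0 < d / 2 by rewrite divr_gt0.
  have d80 : 0 < (d / 2) ^+ 2 / 2 by rewrite divr_gt0// exprn_gt0.
  have [N1 hN1] := bessel_increments dot_norm u_on x d80.
  have /cvg_rnormP /(_ _ d20) [N2 _ hN2] := Elim x.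
  exists (maxn N1.*2 N2) => // k /=; rewrite geq_max => /andP[k1 k2].
  rewrite subr0 QE partial_sumE opprD addrA.
  have h1 : rnorm (E x - fourier_sum dot e k.+1.*2 x) <= d / 2.
    rewrite -rnormN opprB; apply: hN2 => /=.
    by rewrite (leq_trans k2)// -addnn ltnW// ltnS leq_addr.
  have h2 : rnorm (corner k.+1 x) <= d / 2.
    rewrite -ler_sqr ?nnegrE ?rnorm_ge0 ?(ltW d20)//.
    apply: le_trans (corner_bound _ _) _.
    have := hN1 k.+1./2 k.+1; rewrite geq_half_double (leq_trans k1)//.
    by move=> /(_ isT); lra.
  by apply: le_trans (rnormB _ _) _; lra.
- move=> n k; rewrite QE partial_sum_basis.
  rewrite {1}/basis_vector linearD/= Etail Ee -/(basis_vector n) ltnS.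
  by case: leqP => _; rewrite ?subrr ?subr0.
Qed.

End ConditionalBasis.

(** * The analytic semigroup *)

Lemma near0_cmod (R : realType) (d : R) : 0 < d ->
  \forall h \near (0 : (R[i] : numFieldType)), cmod h <= d.
Proof.
move=> d0; have d0' : 0 < d%:C :> R[i] by rewrite ltcR.
have := @cvgr0_norm_le _ _ _ (nbhs (0 : (R[i] : numFieldType))) _ id cvg_id _ d0'.
by move=> /(_ (nbhs_filter _)); apply: filterS => h; rewrite cmodE lecR.
Qed.

Lemma near0_right (R : realType) (d : R) : 0 < d ->
  \forall t \near (0 : R)^'+, 0 < t <= d.
Proof.
move=> d0; near=> t; apply/andP; split; near: t.
- exact: nbhs_right_gt.
- exact: nbhs_right_le.
Unshelve. all: by end_near. Qed.

Section Sectors.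
Variable R : realType.
Implicit Types z : R[i].

Definition open_cone : set R[i] :=
  [set z | `|complex.Im z| < complex.Re z].

(** The half-angle 1/2 is below pi/4, and the elementary bounds on sine and
    cosine already suffice for it. *)
Lemma sector_open_cone z : sector (1 / 2) z -> open_cone z.
Proof.
case=> r [phi [r0 phi2 ->]]; rewrite /open_cone /=.
rewrite normrM (gtr0_norm r0) ltr_pM2l//.
have := norm_sin_le phi; have := norm_cosB1_le phi.
by rewrite ler_norml => /andP[h _]; lra.
Qed.

Lemma open_cone_Re z : open_cone z -> 0 < complex.Re z.
Proof. by rewrite /open_cone /=; apply: le_lt_trans. Qed.

Lemma open_coneW z : open_cone z -> cone z.
Proof. by move=> h; split; apply: ltW => //; exact: open_cone_Re. Qed.

Lemma coneD z w : cone z -> cone w -> cone (z + w).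
Proof.
case: z w => [a b] [c d] [/= a0 ba] [/= c0 dc]; split => /=.
  by rewrite addr_ge0.
by apply: le_trans (ler_normD _ _) _; rewrite lerD.
Qed.

Lemma cone_real (t : R) : 0 <= t -> cone t%:C.
Proof. by move=> t0; split => //=; rewrite normr0. Qed.

Lemma open_cone_near z : open_cone z -> exists2 d : R, 0 < d &
  forall h, cmod h <= d -> cone (z + h).
Proof.
move=> zc; exists ((complex.Re z - `|complex.Im z|) / 2).
  by rewrite divr_gt0// subr_gt0.
move=> h hd; have h1 := normRe_le h; have h2 := normIm_le h.
move: zc h1 h2 hd; rewrite /open_cone /cone /=.
move: (cmod h) => m; case: z h => [a b] [c d] /= ba.
rewrite !ler_norml => /andP[h1 h2] /andP[h3 h4] h5.
have b0 := normr_ge0 b; have h6 := ler_norm b; have h7 := ler_norm (- b).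
rewrite normrN in h7.
by split; rewrite ?ler_norml; lra.
Qed.

Lemma decay_to1 n (d : R) : 0 < d -> exists2 r : R, 0 < r &
  forall z, cmod z <= r -> cmod (decay z n - 1) <= d.
Proof.
move=> d0; have l0 := rate_gt0 R n.
have c0 : 0 < (1 + 4 * expR 1) * rate R n.
  by rewrite mulr_gt0//; have := expR_gt0 (1 : R); lra.
exists (Num.min (rate R n)^-1 (d / ((1 + 4 * expR 1) * rate R n))).
  by rewrite lt_min invr_gt0 l0 divr_gt0.
move=> z; rewrite le_min => /andP[h1 h2].
apply: le_trans (decay_near1 _) _.
  by rewrite mulrC -ler_pdivlMr// mul1r.
by move: h2; rewrite ler_pdivlMr// mulrC.
Qed.

End Sectors.

(** A semigroup that acts on the n-th eigenspace by multiplication by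
    exp (- 4^n z) is obtained by applying the functional calculus to these
    exponentials. *)
Section Semigroup.
Variables (R : realType) (X : completeNormedModType R[i]).
Variables (Q : nat -> {linear X -> X}) (K : R).
Hypothesis Q_bound : forall k x, rnorm (Q k x) <= K * rnorm x.
Hypothesis Q_chain : forall k l x, Q k (Q l x) = Q (maxn k l) x.
Hypothesis Q_to0 : forall x, Q k x @[k --> \oo] --> (0 : X).

Lemma ex_decay_family : exists S : R[i] -> {linear X -> X},
  forall z, cone z -> multiplier Q (decay z) (S z).
Proof.
have ex z : exists S : {linear X -> X}, cone z -> multiplier Q (decay z) S; last first.
  by have [S SP] := choice ex; exists S.
have [zc|nz] := pselect (cone z); last by exists (Q 0%N).
have [S SM] := ex_multiplier Q_bound (fun N => decay_variation N zc).
by exists S.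
Qed.

Variable S : R[i] -> {linear X -> X}.
Hypothesis S_decay : forall z, cone z -> multiplier Q (decay z) (S z).

Lemma decay_family_bound z x : cone z ->
  rnorm (S z x) <= (1 + `|K| * 3) * expR (- complex.Re z) * rnorm x.
Proof.
move=> zc; have := multiplier_bound Q_bound (fun N => decay_variation N zc) (S_decay zc) x.
by rewrite cmod_decay0 mulrA -[X in X + _]mul1r -mulrDl.
Qed.

Lemma decay_family_continuous z : cone z -> continuous (S z).
Proof.
by move=> zc; apply: bounded_linear_cont => x; exact: decay_family_bound.
Qed.

Lemma decay_family0 x : S 0 x = x.
Proof.
have c0 : cone (0 : R[i]) by split; rewrite //= normr0.
have h := S_decay c0; rewrite (_ : decay 0 = fun=> 1) in h; last first.
  by apply/funext => n; rewrite decay_at0.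
exact: multiplier_unique h (multiplier1 Q) x.
Qed.

Lemma decay_familyD z w x : cone z -> cone w -> S (z + w) x = S z (S w x).
Proof.
move=> zc wc; apply: (multiplierM Q_bound Q_chain (fun N => decay_variation N zc)
  (S_decay zc) (S_decay wc)).
rewrite (_ : (fun n => _) = decay (z + w)); first exact/S_decay/coneD.
by apply/funext => n; rewrite decayD.
Qed.

Lemma decay_family_to_id (T : Type) (FT : set_system T) {FF : Filter FT}
    (z : T -> R[i]) x :
  (\forall t \near FT, cone (z t)) ->
  (forall d, 0 < d -> \forall t \near FT, cmod (z t) <= d) ->
  S (z t) x @[t --> FT] --> x.
Proof.
move=> zc z0.
apply: (multiplier_to_id (F := fun t => S (z t)) (q := fun t => decay (z t)) (D := 3)) => //.
- apply: filterS zc => t tc; split=> [|N]; first exact: S_decay.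
  apply: le_trans (decay_variation N tc) _; rewrite -[leRHS]mulr1 ler_wpM2l//.
  by rewrite expR_le1 oppr_le0; case: tc.
- move=> n d d0; have [r r0 hr] := decay_to1 n d0.
  by apply: filterS (z0 _ r0) => t; exact: hr.
Qed.

Lemma decay_family_holomorphic (U : set R[i]) :
  (forall z, U z -> open_cone z) -> holomorphic_on U S.
Proof.
move=> Uc z /Uc zc; have x0 := open_cone_Re zc; set x := complex.Re z in x0.
have [S' S'M] := ex_multiplier Q_bound (fun N => geometric_variation N
  (fun n => @decay'_bound R z n x0)).
exists S'; split.
  apply: bounded_linear_cont => y.
  exact: (multiplier_bound Q_bound (fun N => geometric_variation N
    (fun n => @decay'_bound R z n x0)) S'M).
move=> eps eps0; have [d d0 hd] := open_cone_near zc.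
pose B := 4 * (27 / (x / 2) ^+ 3).
have x20 : 0 < x / 2 by rewrite divr_gt0.
have B0 : 0 < B by rewrite mulr_gt0// divr_gt0// exprn_gt0.
have c0 : 0 < B * (1 + `|K| * 2) by rewrite mulr_gt0// ltr_wpDr// mulr_ge0.
near=> h => y.
have h1 : cmod h <= d by near: h; exact: near0_cmod.
have h2 : cmod h <= x / 2 by near: h; exact: near0_cmod.
have h3 : cmod h <= eps / (B * (1 + `|K| * 2)).
  by near: h; apply: near0_cmod; rewrite divr_gt0.
pose r n := decay (z + h) n - decay z n - h * decay' z n.
have rM : multiplier Q r (fun y => S (z + h) y - S z y - h *: S' y).
  have := multiplier_lin (multiplier_lin (S_decay (hd _ h1))
    (S_decay (open_coneW zc)) (a := 1)) S'M (a := h).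
  rewrite (_ : (fun n => _) = r); last by apply/funext => n; rewrite mul1r.
  by rewrite (_ : (fun y => _) = fun y => S (z + h) y - S z y - h *: S' y)//;
    apply/funext => t; rewrite scale1r.
have rB n : cmod (r n) <= B * cmod h ^+ 2 / rate R n by exact: decay_taylor.
have := multiplier_bound Q_bound (fun N => geometric_variation N rB) rM y.
have r0 : cmod (r 0%N) <= B * cmod h ^+ 2.
  by have := rB 0%N; rewrite /rate expr0 divr1.
rewrite !rnormE cmodE -!rmorphM/= lecR => /le_trans; apply.
rewrite ler_wpM2r ?rnorm_ge0//.
apply: (@le_trans _ _ (B * (1 + `|K| * 2) * cmod h * cmod h)).
  have : 0 <= `|K| by [].
  move: r0; set A := B * cmod h ^+ 2 => rA K0.
  have -> : B * (1 + `|K| * 2) * cmod h * cmod h = A + `|K| * (2 * A).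
    by rewrite /A; ring.
  by rewrite lerD2r.
rewrite ler_wpM2r ?cmod_ge0// mulrC -ler_pdivlMr//.
Unshelve. all: by end_near. Qed.

Definition decay_semigroup (t : R) : {linear X -> X} := S t%:C.

Lemma decay_semigroup_C0 : C0_semigroup decay_semigroup.
Proof.
split.
- by move=> t t0; apply: decay_family_continuous; exact: cone_real.
- by move=> x; rewrite /decay_semigroup rmorph0 decay_family0.
- move=> s t x s0 t0; rewrite /decay_semigroup rmorphD/=.
  by apply: decay_familyD; exact: cone_real.
- move=> x; apply: decay_family_to_id => [|d d0].
    by apply: filterS (near0_right (ltr01)) => t /andP[t0 _]; exact/cone_real/ltW.
  apply: filterS (near0_right d0) => t /andP[t0 td].
  by rewrite cmodC gtr0_norm.
Qed.

Lemma decay_semigroup_stable : exponentially_stable decay_semigroup.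
Proof.
exists (1 + `|K| * 3), 1; split=> // t x t0.
by rewrite mulN1r; exact: (decay_family_bound x (cone_real t0)).
Qed.

Lemma decay_semigroup_analytic : analytic_semigroup decay_semigroup.
Proof.
exists (1 / 2), S; split=> //.
- by have := pihalf_ge1 R; lra.
- by move=> z /sector_open_cone/open_coneW; exact: decay_family_continuous.
- move=> z w x /sector_open_cone/open_coneW zc /sector_open_cone/open_coneW wc.
  exact: decay_familyD.
- split; first by apply: decay_family_holomorphic => z; exact: sector_open_cone.
  move=> theta x /andP[_ th2]; apply: decay_family_to_id => [|d d0].
    apply: filterS (@withinT _ (nbhs (0 : (R[i] : numFieldType))) (sector theta) _) => z.
    case=> r [phi [r0 phith ->]]; apply/open_coneW/sector_open_cone.
    by exists r, phi; split => //; exact: lt_trans th2.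
  by apply: filterS (near0_cmod d0) => z zd _.
Qed.

End Semigroup.

(** * Quadratic Lyapunov functions *)

Lemma limf_esup_near (R : realType) (F : set_system R) {FF : Filter F}
    (f : R -> R) (l eps : R) :
  (limf_esup (fun t => (f t)%:E) F <= l%:E)%E -> 0 < eps ->
  \forall t \near F, f t <= l + eps.
Proof.
move=> fl eps0.
have : (limf_esup (fun t => (f t)%:E) F < (l + eps)%:E)%E.
  by apply: le_lt_trans fl _; rewrite lte_fin ltrDl.
rewrite limf_esupE => /ereal_inf_lt[_ [A FA <-] hA].
apply: filterS FA => t At; rewrite -lee_fin; apply/ltW/le_lt_trans/hA.
by apply: ereal_sup_ubound; exists t.
Qed.

Lemma cvg_expR_quotient (R : realType) (c : R) :
  h^-1 * (expR (- (c * h)) - 1) @[h --> (0 : R)^'+] --> - c.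
Proof.
apply/cvgrPdist_le => eps eps0.
pose M := c ^+ 2 * expR `|c|.
have M0 : 0 <= M by rewrite mulr_ge0 ?sqr_ge0 ?expR_ge0.
have M1 : 0 < M + 1 by lra.
have d0 : 0 < Num.min 1 (eps / (M + 1)) by rewrite lt_min ltr01 divr_gt0.
apply: filterS (near0_right d0) => h /andP[h0]; rewrite le_min => /andP[h1].
rewrite ler_pdivlMr// => h2.
rewrite -normrN opprB.
have -> : h^-1 * (expR (- (c * h)) - 1) - - c =
    h^-1 * (expR (- (c * h)) - 1 - (- (c * h))) by field; rewrite gt_eqF.
rewrite normrM gtr0_norm ?invr_gt0// mulrC ler_pdivrMr//.
apply: le_trans (norm_expR_rem _) _; rewrite sqrrN normrN exprMn.
have e1 : expR `|c * h| <= expR `|c|.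
  by rewrite ler_expR normrM (gtr0_norm h0) -[leRHS]mulr1 ler_wpM2l.
have h20 : 0 <= c ^+ 2 * h ^+ 2 by rewrite mulr_ge0 ?sqr_ge0.
apply: (@le_trans _ _ (M * h * h)).
  by have := ler_wpM2l h20 e1; rewrite /M; lra.
by rewrite ler_wpM2r ?(ltW h0)//; lra.
Qed.

Section QuadraticLyapunov.
Variables (R : realType) (X : completeNormedModType R[i]).
Variable dot : {dot X for Num.conj}.
Variables (P : {linear X -> X}) (V : X -> R).
Hypothesis P_sa : self_adjoint dot P.
Hypothesis V_P : forall x, (V x)%:C = dot (P x) x.
Implicit Types (x y : X) (r s : R).

(** Real combinations of eigenvectors suffice below, and for these the real part
    of the sesquilinear form of P is a symmetric bilinear form. *)
Definition real_form x y : R := complex.Re (dot (P x) y).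

Lemma real_formC x y : real_form x y = real_form y x.
Proof.
by rewrite /real_form P_sa dotC; case: (dot _ _).
Qed.

Lemma real_formDl x y z : real_form (x + y) z = real_form x z + real_form y z.
Proof. by rewrite /real_form linearD dotDl raddfD. Qed.

Lemma real_form_suml (F : nat -> X) m n z :
  real_form (\sum_(m <= i < n) F i) z = \sum_(m <= i < n) real_form (F i) z.
Proof.
rewrite /real_form linear_sum dot_suml.
by rewrite raddf_sum.
Qed.

Lemma quadratic_real_form x : V x = real_form x x.
Proof. by rewrite /real_form -V_P. Qed.

Lemma quadraticD x y : V (x + y) = V x + V y + 2 * real_form x y.
Proof.
rewrite !quadratic_real_form real_formDl ![real_form _ (x + y)]real_formC.
rewrite !real_formDl (real_formC y x); lra.
Qed.

Lemma real_formZl r x y : real_form (r%:C *: x) y = r * real_form x y.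
Proof.
rewrite /real_form linearZ dotZl /=; case: (dot _ _) => a b /=.
by rewrite mul0r subr0.
Qed.

Lemma real_formZ r s x y : real_form (r%:C *: x) (s%:C *: y) = r * s * real_form x y.
Proof. by rewrite real_formZl real_formC real_formZl real_formC mulrA. Qed.

Lemma quadraticZ r x : V (r%:C *: x) = r ^+ 2 * V x.
Proof. by rewrite !quadratic_real_form real_formZ expr2. Qed.

(** By homogeneity, the value of the comparison function at 1 decides. *)
Lemma coercive_quadratic : coercive V ->
  exists2 c : R, 0 < c & forall x, c * rnorm x ^+ 2 <= V x.
Proof.
move=> [alpha [[_ mono a0 _] aV]]; exists (alpha 1).
  by rewrite -a0; apply: mono; rewrite ?in_itv//= ?lexx ?ler01.
move=> x; have [->|x0] := eqVneq x 0.
  by rewrite rnorm0 expr0n/= mulr0; apply: le_trans (aV 0); rewrite rnorm0 a0.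
have nx : 0 < rnorm x by rewrite lt_def rnorm_eq0 x0 rnorm_ge0.
have := aV ((rnorm x)^-1%:C *: x); rewrite rnormZ cmodC ger0_norm ?invr_ge0 ?(ltW nx)//.
by rewrite mulVf ?gt_eqF// quadraticZ exprVn mulrC ler_pdivlMr// exprn_gt0.
Qed.

Variable T : R -> {linear X -> X}.
Hypothesis V_lyap : lyapunov_function T V.

Lemma lyapunov_bounded_on_balls (r : R) : 0 <= r ->
  exists C : R, forall x, rnorm x <= r -> V x <= C.
Proof.
move=> r0; case: V_lyap => _ _ [a2 [_ [[_ mono a0 _] _ Va _]]].
have a2_le s t : 0 <= s -> s <= t -> a2 s <= a2 t.
  move=> s0; rewrite le_eqVlt => /orP[/eqP->//|st].
  by apply/ltW/mono => //; rewrite in_itv/= andbT// (le_trans s0)// ltW.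
exists (a2 r) => x xr; have [->|x0] := eqVneq x 0.
  have -> : V 0 = 0.
    by have := quadraticZ 0 0; rewrite scaler0 expr0n/= mul0r.
  by rewrite -a0 a2_le.
by have /andP[_ /le_trans] := Va _ x0; apply; rewrite a2_le ?rnorm_ge0.
Qed.

Lemma lyapunov_decrease x (eps : R) : 0 < eps ->
  \forall h \near (0 : R)^'+, h^-1 * (V (T h x) - V x) <= eps.
Proof.
move=> eps0; case: V_lyap => _ _ [_ [a3 [_ [_ mono a0 _] _ Va]]].
have near_le := limf_esup_near (Va x) eps0.
apply: filterS (near_le _) => h /le_trans; apply.
rewrite gerDr oppr_le0.
have := rnorm_ge0 x; rewrite le_eqVlt => /orP[/eqP<-|nx]; first by rewrite a0.
by rewrite -a0; apply/ltW/mono; rewrite ?in_itv//= ?lexx// ltW.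
Qed.

(** The right-hand side is -1/2 times the derivative at 0 of V along the
    trajectory of f + g, which is a sum of three exponentials. *)
Lemma eigenvectors_dissipation (f g : X) (a b : R) :
  (forall t, 0 <= t -> T t f = (expR (- (a * t)))%:C *: f) ->
  (forall t, 0 <= t -> T t g = (expR (- (b * t)))%:C *: g) ->
  0 <= a * V f + b * V g + (a + b) * real_form f g.
Proof.
move=> Tf Tg.
pose E (c h : R) := h^-1 * (expR (- (c * h)) - 1).
pose q h := V f * E (2 * a) h + V g * E (2 * b) h + 2 * real_form f g * E (a + b) h.
have qE h : 0 < h -> h^-1 * (V (T h (f + g)) - V (f + g)) = q h.
  move=> h0; rewrite linearD/= Tf ?Tg ?(ltW h0)// !quadraticD !quadraticZ real_formZ.
  rewrite /q /E.
  have -> : expR (- (2 * a * h)) = expR (- (a * h)) ^+ 2.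
    by rewrite expr2 -expRD; congr expR; ring.
  have -> : expR (- (2 * b * h)) = expR (- (b * h)) ^+ 2.
    by rewrite expr2 -expRD; congr expR; ring.
  have -> : expR (- ((a + b) * h)) = expR (- (a * h)) * expR (- (b * h)).
    by rewrite -expRD; congr expR; ring.
  ring.
pose L := V f * (- (2 * a)) + V g * (- (2 * b)) + 2 * real_form f g * (- (a + b)).
have qL : q h @[h --> (0 : R)^'+] --> L.
  by apply: cvgD; [apply: cvgD|]; apply: cvgMr; exact: cvg_expR_quotient.
suff : L <= 0 by rewrite /L; lra.
apply/ler_addgt0Pl => eps eps0; rewrite addr0.
have eps20 : 0 < eps / 2 by rewrite divr_gt0.
have h1 : \forall h \near (0 : R)^'+, `|L - q h| <= eps / 2.
  by move/cvgrPdist_le: qL; apply.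
have h2 := lyapunov_decrease (f + g) eps20.
have /(@filter_ex _ _ (at_right_proper_filter (0 : R)))[h [hL [hq /andP[h0 _]]]] : \forall h \near (0 : R)^'+,
    `|L - q h| <= eps / 2 /\ h^-1 * (V (T h (f + g)) - V (f + g)) <= eps / 2 /\
    0 < h <= 1.
  by apply: filterS3 h1 h2 (near0_right (@ltr01 R)) => h.
by move: hq hL; rewrite qE// ler_norml => hq /andP[_]; lra.
Qed.

Variable F : nat -> X.
Hypothesis T_eigen : forall n t, 0 <= t ->
  T t (F n) = (expR (- (rate R n * t)))%:C *: F n.
Variable C : R.
Hypothesis V_F : forall n, V (F n) <= C.

(** Rescaling the two eigenvectors by the inverse square roots of their rates
    turns dissipation into exponential decay of the off-diagonal entries. *)
Lemma almost_orthogonal m n : `|real_form (F m) (F n)| * 2 ^+ n <= 2 * C * 2 ^+ m.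
Proof.
(* The square roots of the rates. *)
pose p : R := 2 ^+ m; pose q : R := 2 ^+ n.
have p0 : 0 < p by rewrite exprn_gt0.
have q0 : 0 < q by rewrite exprn_gt0.
have rp : rate R m = p ^+ 2 by rewrite /rate /p -exprM mulnC exprM; congr (_ ^+ _); ring.
have rq : rate R n = q ^+ 2 by rewrite /rate /q -exprM mulnC exprM; congr (_ ^+ _); ring.
have key (s : R) : s ^+ 2 = 1 ->
    0 <= V (F m) + V (F n) + s * ((p ^+ 2 + q ^+ 2) / (p * q)) * real_form (F m) (F n).
  move=> s1.
  have eig k (r t : R) : 0 <= t -> T t (r%:C *: F k) =
      (expR (- (rate R k * t)))%:C *: (r%:C *: F k).
    by move=> t0; rewrite linearZ/= T_eigen// !scalerA mulrC.
  have := eigenvectors_dissipation (eig m p^-1) (eig n (s / q)).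
  rewrite !quadraticZ real_formZ rp rq exprMn s1 mul1r !exprVn.
  rewrite !mulrA !divff ?expf_neq0 ?gt_eqF// !mul1r.
  move=> /le_trans; apply; rewrite le_eqVlt; apply/orP; left; apply/eqP.
  field.
  by rewrite !gt_eqF.
have c1 : 0 < p * q by rewrite mulr_gt0.
have h1 := key 1 (expr1n _ _).
have /key h2 : (-1 : R) ^+ 2 = 1 by rewrite sqrrN expr1n.
have VF := V_F m; have VG := V_F n.
have h3 : `|real_form (F m) (F n)| * ((p ^+ 2 + q ^+ 2) / (p * q)) <= 2 * C.
  have : 0 <= (p ^+ 2 + q ^+ 2) / (p * q).
    by rewrite divr_ge0 ?addr_ge0 ?sqr_ge0 ?(ltW c1).
  move: h1 h2; move: ((p ^+ 2 + q ^+ 2) / (p * q)) => k h1 h2 k0.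
  by rewrite -(ger0_norm k0) -normrM ler_norml; lra.
have h4 : `|real_form (F m) (F n)| * (q / p) <= 2 * C.
  apply: le_trans h3; rewrite ler_wpM2l//.
  rewrite -subr_ge0 (_ : _ - _ = p / q) ?divr_ge0 ?ltW//.
  by field; rewrite !gt_eqF.
by move: h4; rewrite mulrA ler_pdivrMr.
Qed.

(** Almost orthogonality bounds V on a sum of eigenvectors by a multiple of the
    number of terms, as if they were orthogonal for V. *)
Lemma block_sum_bounded M N : (M <= N)%N ->
  V (\sum_(M <= n < N) F n) <= 5 * C * (N - M)%:R.
Proof.
have C0 : 0 <= C by apply: le_trans (V_F 0); case: V_lyap.
elim: N => [|N IH].
  rewrite leqn0 => /eqP ->; rewrite big_geq// subnn mulr0.
  by have := quadraticZ 0 0; rewrite scaler0 expr0n/= mul0r => ->.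
rewrite leq_eqVlt => /orP[/eqP->|].
  rewrite big_geq// subnn mulr0.
  by have := quadraticZ 0 0; rewrite scaler0 expr0n/= mul0r => ->.
rewrite ltnS => MN; rewrite big_nat_recr//= quadraticD subSn// -[(N - M).+1%:R]natr1.
suff : real_form (\sum_(M <= n < N) F n) (F N) <= 2 * C.
  by have := IH MN; have := V_F N; rewrite mulrDr mulr1; lra.
have p0 : 0 < 2 ^+ N :> R by rewrite exprn_gt0.
rewrite real_form_suml -(ler_pM2r p0) mulr_suml.
apply: (@le_trans _ _ (\sum_(M <= n < N) 2 * C * 2 ^+ n)).
  apply: ler_sum => n _; apply: le_trans (almost_orthogonal n N).
  by rewrite ler_wpM2r ?(ltW p0)// ler_norm.
rewrite -mulr_sumr ler_wpM2l ?mulr_ge0//.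
elim: (N) MN {IH p0} => [|k IHk]; first by rewrite leqn0 => /eqP->; rewrite big_geq.
rewrite leq_eqVlt => /orP[/eqP->|]; first by rewrite big_geq ?exprn_ge0.
by rewrite ltnS => Mk; rewrite big_nat_recr//= exprS; have := IHk Mk; lra.
Qed.

End QuadraticLyapunov.

(** * The main result *)

Theorem proposition8 (R : realType) (X : completeNormedModType R[i])
    (dot : {dot X for Num.conj}) (dot_norm : norm_induced_by dot)
    (X_infinite : infinite_dimensional X) :
  exists (D : set X) (A : X -> X) (T : R -> {linear X -> X}),
    [/\ C0_semigroup T,
        generator D A T,
        exponentially_stable T,
        analytic_semigroup T &
        ~ exists V : X -> R,
            [/\ lyapunov_function T V, coercive V & quadratic dot V]].
Proof.
have [e e_on] := ex_orthonormal_sequence dot_norm X_infinite.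
have [Q [Q_bound Q_chain Q_to0 Q_basis]] := ex_projection_chain dot_norm e_on.
have [S S_decay] := ex_decay_family Q_bound.
pose T := decay_semigroup S.
(* The generator is read off from its definition: domain and values are those
   of the limit of the difference quotients. *)
exists [set x | cvg (difference_quotient T x h @[h --> (0 : R)^'+])].
exists (fun x => lim (difference_quotient T x h @[h --> (0 : R)^'+])), T.
split.
- exact: (decay_semigroup_C0 Q_bound Q_chain Q_to0 S_decay).
- by split.
- exact: (decay_semigroup_stable Q_bound S_decay).
- exact: (decay_semigroup_analytic Q_bound Q_chain Q_to0 S_decay).
move=> [V [V_lyap V_coercive [P [_ P_sa V_P]]]].
pose f := basis_vector e.
have T_eigen n t : 0 <= t -> T t (f n) = (expR (- (rate R n * t)))%:C *: f n.
  move=> t0; rewrite -decay_real.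
  exact: (multiplier_eigen (Q_basis n) (S_decay _ (cone_real t0))).
have [C hC] := lyapunov_bounded_on_balls P_sa V_P V_lyap (ler0n R 3).
have V_f n : V (f n) <= C by apply: hC; exact: (basis_vector_bound dot_norm e_on).
have [c c0 hc] := coercive_quadratic P_sa V_P V_coercive.
have [M [N [MN]]] := block_sum_large dot_norm e_on (5 * C / c).
rewrite ltNge => /negP; apply.
rewrite mulrAC ler_pdivlMr// mulrC; apply: le_trans (hc _) _.
exact: (block_sum_bounded P_sa V_P V_lyap T_eigen V_f (ltnW MN)).
Qed.
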